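(* Let $s>3/2$, $\kappa\in\mathbb{R}$, and let $v_0\in H^s(\mathbb{S})$ (real-valued) be such that $$v_0'(a)<-\sqrt{\tfrac32}\,\bigl|v_0(a)+\kappa\bigr|\qquad\text{for some } a\in\mathbb{S}.$$ Let $v\in C([0,T^* ),H^s(\mathbb{S}))\cap C^1([0,T^* ),H^{s-1}(\mathbb{S}))$ be the maximal solution, with maximal existence time $T^*\in(0,+\infty]$, of the problem $$v_t+vv_x+\partial_x p*\Bigl(\tfrac32 v^2+3\kappa v\Bigr)=0,\quad t>0,\ x\in\mathbb{S},\qquad v(0,x)=v_0(x),\quad x\in\mathbb{S}.$$ Then $v$ blows up in finite time, i.e. $T^*<+\infty$.
   Context: $\mathbb{S}=\mathbb{R}/\mathbb{Z}$ is the circle of length $1$; functions on $\mathbb{S}$ are identified with $1$-periodic functions on $\mathbb{R}$, and $H^s(\mathbb{S})$ is the usual $L^2$-based Sobolev space (real-valued functions). For $s>3/2$ elements of $H^s(\mathbb{S})$ are identified with their $C^1$ representatives, so pointwise values of $v_0$ and $v_0'$ make sense. The kernel $p$ is the kernel of $(1-\partial_x^2)^{-1}$ on $\mathbb{S}$, i.e. the continuous $1$-periodic function $$p(x)=\frac{\cosh(x-[x]-1/2)}{2\sinh(1/2)},$$ where $[x]$ is the integer part of $x$, and $*$ denotes convolution on $\mathbb{S}$ in the $x$ variable. The equation is the Degasperis-Procesi equation with dispersion parameter $\kappa$. It is known that for $s>3/2$ the Cauchy problem has a unique local solution in $C([0,T),H^s(\mathbb{S}))\cap C^1([0,T),H^{s-1}(\mathbb{S}))$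 for some $T>0$; $T^*$ denotes the supremum of the times $T$ for which such a solution exists. *)

(* Defs.v *)
From HB Require Import structures.
From mathcomp Require Import all_boot all_order all_algebra.
From mathcomp Require Import all_classical all_reals all_analysis.

Set Implicit Arguments.
Unset Strict Implicit.
Unset Printing Implicit Defensive.

Import Order.TTheory GRing.Theory Num.Theory.
Import numFieldNormedType.Exports.

Local Open Scope classical_set_scope.
Local Open Scope ring_scope.

(* Functions on the circle S = R/Z are 1-periodic functions on the line, and
   integrals over S are Lebesgue integrals over [0, 1]. *)

Definition periodic1 (R : realType) (f : R -> R) : Prop :=
  forall x : R, f (x + 1) = f x.

Definition circle_integral (R : realType) (f : R -> R) : R :=
  \int[lebesgue_measure]_(x in `[0%R, 1%R]) f x.

(* The Fourier coefficient of a real-valued f at k is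
     int_S f(x) exp(-2 pi i k x) dx = fourier_re f k - i * fourier_im f k. *)
Definition fourier_re (R : realType) (f : R -> R) (k : int) : R :=
  circle_integral (fun x => f x * cos (2 * pi * k%:~R * x)).

Definition fourier_im (R : realType) (f : R -> R) (k : int) : R :=
  circle_integral (fun x => f x * sin (2 * pi * k%:~R * x)).

Definition fourier_normsq (R : realType) (f : R -> R) (k : int) : R :=
  fourier_re f k ^+ 2 + fourier_im f k ^+ 2.

Definition sobolev_norm (R : realType) (s : R) (f : R -> R) : \bar R :=
  sqrte (\esum_(k in [set: int])
    ((1 + k%:~R ^+ 2) `^ s * fourier_normsq f k)%:E).

Definition L2_circle (R : realType) (f : R -> R) : Prop :=
  [/\ periodic1 f, measurable_fun [set: R] f &
      (lebesgue_measure : set R -> \bar R).-integrable `[0%R, 1%R]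
        (fun x => (f x ^+ 2)%:E)].

(* H^s(S) as a subspace of L^2(S); this is the Sobolev space for s >= 0 only,
   the elements being functions and not distributions. *)
Definition sobolev (R : realType) (s : R) (f : R -> R) : Prop :=
  L2_circle f /\ (sobolev_norm s f < +oo)%E.

Definition C1_fun (R : realType) (f : R -> R) : Prop :=
  (forall x : R, derivable f x 1) /\ continuous (derive1 f).

(* H^s(S) for s > 3/2, each class being identified with its C^1
   representative. *)
Definition sobolev_C1 (R : realType) (s : R) (f : R -> R) : Prop :=
  sobolev s f /\ C1_fun f.

Definition time_interval (R : realType) (T : \bar R) : set R :=
  [set t : R | 0 <= t /\ (t%:E < T)%E].

Definition continuous_sobolev (R : realType) (s : R) (T : \bar R)
    (v : R -> R -> R) : Prop :=
  forall t : R, time_interval T t ->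
    sobolev_norm s (fun x => v r x - v t x)
      @[r --> within (time_interval T) (nbhs t)] --> 0%E.

(* w is the time derivative of v in H^s, one-sided at t = 0. *)
Definition sobolev_time_derivative (R : realType) (s : R) (T : \bar R)
    (v w : R -> R -> R) : Prop :=
  forall t : R, time_interval T t ->
    sobolev_norm s (fun x => (r - t)^-1 * (v r x - v t x) - w t x)
      @[r --> within (time_interval T) t^'] --> 0%E.

Definition cosh (R : realType) (x : R) : R := (expR x + expR (- x)) / 2.

Definition sinh (R : realType) (x : R) : R := (expR x - expR (- x)) / 2.

Definition DP_kernel (R : realType) (x : R) : R :=
  cosh (x - (Num.floor x)%:~R - 1 / 2) / (2 * sinh (1 / 2)).

Definition circle_conv (R : realType) (f g : R -> R) (x : R) : R :=
  circle_integral (fun y => f (x - y) * g y).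

(* The equation holds in H^(s-1)(S), hence almost everywhere in x for each t:
   only v t, not its time derivative vt t, comes with a preferred
   representative. *)
Definition DP_solution (R : realType) (s kappa : R) (v0 : R -> R) (T : \bar R)
    (v : R -> R -> R) : Prop :=
  [/\ forall t : R, time_interval T t -> sobolev_C1 s (v t),
      continuous_sobolev s T v,
      forall x : R, v 0 x = v0 x &
      exists vt : R -> R -> R,
        [/\ forall t : R, time_interval T t -> sobolev (s - 1) (vt t),
            continuous_sobolev (s - 1) T vt,
            sobolev_time_derivative (s - 1) T v vt &
            forall t : R, 0 < t -> (t%:E < T)%E ->
              {ae lebesgue_measure, forall x : R,
                 vt t x + v t x * derive1 (v t) x
                 + derive1 (circle_conv (@DP_kernel R)
                     (fun y => 3 / 2 * v t y ^+ 2 + 3 * kappa * v t y)) x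
                 = 0}]].

Definition existence_times (R : realType) (s kappa : R) (v0 : R -> R) : set R :=
  [set T : R | 0 < T /\ exists v, DP_solution s kappa v0 T%:E v].

Definition DP_maximal_solution (R : realType) (s kappa : R) (v0 : R -> R)
    (Tstar : \bar R) (v : R -> R -> R) : Prop :=
  [/\ (0 < Tstar)%E,
      Tstar = ereal_sup (EFin @` existence_times s kappa v0) &
      DP_solution s kappa v0 Tstar v].

(* Main.v *)
Require Import Defs.
From HB Require Import structures.
From mathcomp Require Import all_boot all_order all_algebra.
From mathcomp Require Import all_classical all_reals all_analysis.
From mathcomp Require Import measurable_realfun.
From mathcomp Require Import ring lra.
Import Order.TTheory GRing.Theory Num.Theory.
Import numFieldNormedType.Exports.
Local Open Scope classical_set_scope.
Local Open Scope ring_scope.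
Set Implicit Arguments.
Unset Strict Implicit.
Unset Printing Implicit Defensive.

(** Put [u = v + kappa], [beta = sqrt (3/2)] and suppose that the
    solution is global. Along a characteristic [q' = v(t, q)] the quantities
    [A = - v_x + beta u] and [B = - v_x - beta u] satisfy
    [A' = A B + 3/2 (p - beta p') * u^2] and [B' = A B + 3/2 (p + beta p') * u^2],
    and [p - beta p'], [p + beta p'] are nonnegative. The hypothesis says that
    both are positive at [t = 0] on the characteristic issued from [a]; then they
    increase, [1/A + 1/B] decreases at rate at least 2, and it would become
    negative in finite time.

    Since [v] has only the regularity [H^s], [s > 3/2], the slope [v_x] is replaced
    by the difference quotient of [v] between the characteristics issued from [a]
    and [a + h], at the price of an error [O(h)] in the Riccati inequalities.
    What is needed of the Sobolev spaces is the embedding of [H^sigma] into bounded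
    functions for [sigma > 1/2]; it comes from Fejer's theorem. *)

(** * Continuity, derivatives and integrals over the circle *)

Section basics.
Context {R : realType}.
Implicit Types f g : R -> R.

(** The equation only sees [g = 3/2 v^2 + 3 kappa v] through [p' * g], so a constant may be added
    and the square completed to [g = 3/2 u^2]. Since [(p * g)'' = p * g - g], the formal equations
    along a characteristic are [(- v_x)' = v_x^2 - 3/2 u^2 + p * g] and [u' = - p' * g]; [beta] is
    the number for which the local terms factor as [A B]. The sign of [p - beta p'] and
    [p + beta p'] is not read off the kernel: [p * g] is split as [X + Y] with [p' * g = X - Y], and
    periodicity gives [X <= e Y] and [Y <= e X] for [g >= 0]. This would suffice for [beta] up to
    [coth (1/2)], which leaves room to replace [e] by 4. The error [O(h)] is harmless because of the
    order of the choices: [d] is half of the margin in the hypothesis, [T = 2 / d] is already too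
    long for the Riccati inequalities, global existence bounds [u] and [v_x] on [[0, T]], and only
    then is [h] taken small. Absorbing the error costs half of the decay of [1/A + 1/B], whose rate
    drops from 2 to 1. *)

Lemma contD f g : continuous f -> continuous g -> continuous (fun x => f x + g x).
Proof. by move=> cf cg x; apply: cvgD; [exact: cf|exact: cg]. Qed.
Lemma contB f g : continuous f -> continuous g -> continuous (fun x => f x - g x).
Proof. by move=> cf cg x; apply: cvgB; [exact: cf|exact: cg]. Qed.
Lemma contN f : continuous f -> continuous (fun x => - f x).
Proof. by move=> cf x; apply: cvgN; exact: cf. Qed.
Lemma contM f g : continuous f -> continuous g -> continuous (fun x => f x * g x).
Proof. by move=> cf cg x; apply: cvgM; [exact: cf|exact: cg]. Qed.
Lemma cont_cst (c : R) : continuous (fun _ : R => c).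
Proof. by move=> x; exact: cvg_cst. Qed.
Lemma cont_id : continuous (fun x : R => x).
Proof. by move=> x; exact: cvg_id. Qed.
Lemma contX f n : continuous f -> continuous (fun x => f x ^+ n).
Proof.
move=> cf; elim: n => [|n IH]; first exact: cont_cst.
by under eq_fun do rewrite exprS; exact: contM.
Qed.
Lemma cont_comp f g : continuous f -> continuous g -> continuous (fun x => f (g x)).
Proof. by move=> cf cg x; apply: (@continuous_comp _ _ _ g f x); [exact: cg|exact: cf]. Qed.
Lemma cont_cos f : continuous f -> continuous (fun x => cos (f x)).
Proof. by apply: cont_comp; exact: continuous_cos. Qed.
Lemma cont_sin f : continuous f -> continuous (fun x => sin (f x)).
Proof. by apply: cont_comp; exact: continuous_sin. Qed.
Lemma cont_expR f : continuous f -> continuous (fun x => expR (f x)).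
Proof. by apply: cont_comp; exact: continuous_expR. Qed.
Lemma cont_norm f : continuous f -> continuous (fun x => `|f x|).
Proof. by move=> cf x; apply: cvg_norm; exact: cf. Qed.
Lemma cont_sum (I : Type) (r : seq I) (F : I -> R -> R) :
  (forall i, continuous (F i)) -> continuous (fun x => \sum_(i <- r) F i x).
Proof.
move=> cF; elim: r => [|i r IH].
  by under eq_fun do rewrite big_nil; exact: cont_cst.
by under eq_fun do rewrite big_cons; exact: contD.
Qed.

Lemma is_deriveD1 (f g : R -> R) (x df dg : R) : is_derive x (1 : R) f df -> is_derive x 1 g dg ->
  is_derive x (1 : R) (fun t => f t + g t) (df + dg).
Proof. by move=> ? ?; exact: is_deriveD. Qed.
Lemma is_deriveB1 (f g : R -> R) (x df dg : R) : is_derive x (1 : R) f df -> is_derive x 1 g dg ->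
  is_derive x (1 : R) (fun t => f t - g t) (df - dg).
Proof. by move=> ? ?; exact: is_deriveB. Qed.
Lemma is_deriveM1 (f g : R -> R) (x df dg : R) : is_derive x (1 : R) f df -> is_derive x 1 g dg ->
  is_derive x (1 : R) (fun t => f t * g t) (df * g x + f x * dg).
Proof.
move=> Hf Hg; have := is_deriveM Hf Hg.
by move=> H; apply: is_derive_eq; rewrite /GRing.scale/= addrC mulrC.
Qed.
Lemma is_deriveC1 (c x : R) : is_derive x (1 : R) (fun _ : R => c) 0.
Proof. exact: is_derive_cst. Qed.
Lemma is_deriveI1 (x : R) : is_derive x (1 : R) (fun t : R => t) 1.
Proof. exact: is_derive_id. Qed.
Lemma is_derive_comp1 (f g : R -> R) (x df dg : R) : is_derive (g x) 1 f df ->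
  is_derive x (1 : R) g dg -> is_derive x 1 (fun t => f (g t)) (df * dg).
Proof. by move=> Hf Hg; exact: is_derive1_comp. Qed.
Lemma is_derive_cont (f : R -> R) (x df : R) : is_derive x (1 : R) f df -> {for x, continuous f}.
Proof. by move=> [Hf _]; apply: differentiable_continuous; exact/derivable1_diffP. Qed.
Lemma is_derive_derive1 (f : R -> R) (x df : R) : is_derive x (1 : R) f df -> derive1 f x = df.
Proof. by move=> [_ Hf]; rewrite derive1E. Qed.
Lemma is_derive_N1 (f : R -> R) (x df : R) : is_derive x (1 : R) f df ->
  is_derive x (1 : R) (fun t => - f t) (- df).
Proof. by move=> ?; exact: is_deriveN. Qed.

Lemma is_derive_sin1 (f : R -> R) (x df : R) : is_derive x (1 : R) f df ->
  is_derive x (1 : R) (fun t => sin (f t)) (cos (f x) * df).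
Proof. by move=> H; exact: (is_derive_comp1 (is_derive_sin (f x)) H). Qed.
Lemma is_derive_cos1 (f : R -> R) (x df : R) : is_derive x (1 : R) f df ->
  is_derive x (1 : R) (fun t => cos (f t)) (- sin (f x) * df).
Proof. by move=> H; exact: (is_derive_comp1 (is_derive_cos (f x)) H). Qed.
Lemma is_derive_expR1 (f : R -> R) (x df : R) : is_derive x (1 : R) f df ->
  is_derive x (1 : R) (fun t => expR (f t)) (expR (f x) * df).
Proof. by move=> H; exact: (is_derive_comp1 (is_derive_expR (f x)) H). Qed.
Lemma is_derive_val_eq (f : R -> R) (x df dg : R) : is_derive x (1 : R) f df -> df = dg ->
  is_derive x (1 : R) f dg.
Proof. by move=> ? <-. Qed.

Lemma derive_ge0_le (f df : R -> R) (a b : R) : a <= b ->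
  {within `[a, b], continuous f} ->
  (forall x, a < x < b -> is_derive x (1 : R) f (df x)) ->
  (forall x, a < x < b -> 0 <= df x) -> f a <= f b.
Proof.
move=> ab cf fd d0.
have H x : x \in `]a, b[ -> is_derive x (1 : R) f (df x).
  by rewrite in_itv/= => ?; exact: fd.
move: ab; rewrite le_eqVlt => /orP[/eqP->//|ab].
have [{}c Hc {}E] := MVT ab H cf.
rewrite -subr_ge0 E mulr_ge0 ?subr_ge0 ?(ltW ab)//; apply: d0.
by move: Hc; rewrite in_itv.
Qed.

Lemma cont_integrable f (a b : R) : continuous f ->
  lebesgue_measure.-integrable `[a, b] (EFin \o f).
Proof.
move=> cf; apply: continuous_compact_integrable; first exact: segment_compact.
exact: continuous_subspaceT.
Qed.

End basics.

Ltac cont := lazymatch goal with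
 | |- continuous (fun t => t) => exact: cont_id
 | |- continuous (fun t => @GRing.add _ (@?f t) (@GRing.opp _ (@?g t))) =>
     apply: (@contB _ f g); cont
 | |- continuous (fun t => @GRing.add _ (@?f t) (@?g t)) => apply: (@contD _ f g); cont
 | |- continuous (fun t => @GRing.opp _ (@?f t)) => apply: (@contN _ f); cont
 | |- continuous (fun t => @GRing.mul _ (@?f t) (@?g t)) => apply: (@contM _ f g); cont
 | |- continuous (fun t => @GRing.exp _ (@?f t) ?n) => apply: (@contX _ f n); cont
 | |- continuous (fun t => @sin _ (@?f t)) => apply: (@cont_sin _ f); cont
 | |- continuous (fun t => @cos _ (@?f t)) => apply: (@cont_cos _ f); cont
 | |- continuous (fun t => @expR _ (@?f t)) => apply: (@cont_expR _ f); cont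
 | |- continuous (fun t => @Num.norm _ _ (@?f t)) => apply: (@cont_norm _ f); cont
 | |- continuous (fun t => \sum_(i <- _) _) =>
     apply: cont_sum; let i := fresh in move=> i; cbv beta; cont
 | |- _ => first [assumption | exact: cont_cst | idtac]
 end.

(* [is_derive] is a class; [notypeclasses refine] keeps instance search from
   filling the premises with derivatives written with [*:]. *)
Ltac deriv := lazymatch goal with
 | |- is_derive _ _ (fun t => t) _ => notypeclasses refine (is_deriveI1 _)
 | |- is_derive ?x _ (fun t => @GRing.add _ (@?f t) (@?g t)) _ =>
     notypeclasses refine (@is_deriveD1 _ f g x _ _ _ _); deriv
 | |- is_derive ?x _ (fun t => @GRing.opp _ (@?f t)) _ =>
     notypeclasses refine (@is_derive_N1 _ f x _ _); deriv
 | |- is_derive ?x _ (fun t => @GRing.mul _ (@?f t) (@?g t)) _ =>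
     notypeclasses refine (@is_deriveM1 _ f g x _ _ _ _); deriv
 | |- is_derive ?x _ (fun t => @sin _ (@?f t)) _ =>
     notypeclasses refine (@is_derive_sin1 _ f x _ _); deriv
 | |- is_derive ?x _ (fun t => @cos _ (@?f t)) _ =>
     notypeclasses refine (@is_derive_cos1 _ f x _ _); deriv
 | |- is_derive ?x _ (fun t => @expR _ (@?f t)) _ =>
     notypeclasses refine (@is_derive_expR1 _ f x _ _); deriv
 | |- _ => first [notypeclasses refine (is_deriveC1 _ _) | eassumption]
 end.

Section circle_integral.
Context {R : realType}.
Implicit Types f g : R -> R.
Let mI : measurable (`[0, 1]%classic : set R) := measurable_itv _.

Lemma eq_circle_integral f g : (forall x, 0 <= x <= 1 -> f x = g x) -> circle_integral f = circle_integral g.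
Proof. by move=> H; apply: eq_Rintegral => x; rewrite inE/= in_itv/= => /H. Qed.
Lemma circle_integralD f g : continuous f -> continuous g ->
  circle_integral (fun x => f x + g x) = circle_integral f + circle_integral g.
Proof. by move=> cf cg; rewrite /circle_integral RintegralD//; exact: cont_integrable. Qed.
Lemma circle_integralB f g : continuous f -> continuous g ->
  circle_integral (fun x => f x - g x) = circle_integral f - circle_integral g.
Proof. by move=> cf cg; rewrite /circle_integral RintegralB//; exact: cont_integrable. Qed.
Lemma circle_integralZ (c : R) f : continuous f ->
  circle_integral (fun x => c * f x) = c * circle_integral f.
Proof. by move=> cf; rewrite /circle_integral RintegralZl//; exact: cont_integrable. Qed.
Lemma circle_integral_cst (c : R) : circle_integral (fun _ => c) = c.
Proof.
rewrite /circle_integral Rintegral_cst//.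
have H : fine (lebesgue_measure (`[0, 1]%classic : set R)) = 1.
  by rewrite lebesgue_measure_itv/= lte_fin ltr01/= subr0.
by exact: etrans (congr1 (fun z => c * z) H) (mulr1 c).
Qed.
Lemma circle_integral_sum (I : Type) (r : seq I) (F : I -> R -> R) : (forall i, continuous (F i)) ->
  circle_integral (fun x => \sum_(i <- r) F i x) = \sum_(i <- r) circle_integral (F i).
Proof.
move=> cF; elim: r => [|i r IH].
  by rewrite big_nil -[RHS](circle_integral_cst 0); apply: eq_circle_integral => x _; rewrite big_nil.
rewrite big_cons -IH -circle_integralD//; last exact: cont_sum.
by apply: eq_circle_integral => x _; rewrite big_cons.
Qed.
Lemma le_circle_integral f g : continuous f -> continuous g -> (forall x, 0 <= x <= 1 -> f x <= g x) ->
  circle_integral f <= circle_integral g.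
Proof.
move=> cf cg H; apply: le_Rintegral => //; exact: cont_integrable.
Qed.
Lemma le_norm_circle_integral f : continuous f -> `|circle_integral f| <= circle_integral (fun x => `|f x|).
Proof. by move=> cf; apply: le_normr_Rintegral => //; exact: cont_integrable. Qed.

Lemma circle_integral_derive (F f : R -> R) : continuous f -> (forall x, is_derive x (1 : R) F (f x)) ->
  circle_integral f = F 1 - F 0.
Proof.
move=> cf dF; rewrite /circle_integral /Rintegral (@continuous_FTC2 _ f F 0 1)//.
- exact: continuous_subspaceT.
- have cF : continuous F by move=> x; exact: is_derive_cont (dF x).
  split => [x _||]; first by case: (dF x).
    exact/cvg_at_right_filter/cF.
  exact/cvg_at_left_filter/cF.
- by move=> x _; rewrite (is_derive_derive1 (dF x)).
Qed.

End circle_integral.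

(** * Fejer means *)

Section fejer.
Context {R : realType}.
Implicit Types f g : R -> R.

(* This is [N] times the usual Fejer kernel. *)
Definition fejer_kernel (N : nat) (y : R) : R :=
  (\sum_(j < N) cos (2 * pi * (j%:Z)%:~R * y)) ^+ 2 +
  (\sum_(j < N) sin (2 * pi * (j%:Z)%:~R * y)) ^+ 2.

Lemma fejer_kernel_ge0 N y : 0 <= fejer_kernel N y.
Proof. by rewrite addr_ge0 ?sqr_ge0. Qed.

(** Multiplied by [2 * sin (pi * y)], both sums telescope, and the squares of the results add up to
    [2 - 2 * cos (2 * pi * N * y)], which is at most 4. The bound does not grow with [N] whereas the
    mass of the kernel is [N]: the kernel concentrates at the integers. *)
Lemma fejer_kernel_sin2_le N y : fejer_kernel N y * sin (pi * y) ^+ 2 <= 1.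
Proof.
have HC : 2 * sin (pi * y) * (\sum_(j < N) cos (2 * pi * (j%:Z)%:~R * y))
   = sin (pi * (2 * N%:R - 1) * y) + sin (pi * y).
  elim: N => [|N IH].
    by rewrite big_ord0 mulr0 mulr0 sub0r mulrN1 mulNr sinN addNr.
  rewrite big_ord_recr/= mulrDr IH.
  have -> : pi * (2 * N.+1%:R - 1) * y = 2 * pi * N%:R * y + pi * y :> R.
    by rewrite -natr1; ring.
  have -> : pi * (2 * N%:R - 1) * y = 2 * pi * N%:R * y - pi * y :> R by ring.
  by rewrite sinB sinD; ring.
have HS : 2 * sin (pi * y) * (\sum_(j < N) sin (2 * pi * (j%:Z)%:~R * y))
   = cos (pi * y) - cos (pi * (2 * N%:R - 1) * y).
  elim: {HC} N => [|N IH].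
    by rewrite big_ord0 mulr0 mulr0 sub0r mulrN1 mulNr cosN subrr.
  rewrite big_ord_recr/= mulrDr IH.
  have -> : pi * (2 * N.+1%:R - 1) * y = 2 * pi * N%:R * y + pi * y :> R.
    by rewrite -natr1; ring.
  have -> : pi * (2 * N%:R - 1) * y = 2 * pi * N%:R * y - pi * y :> R by ring.
  by rewrite cosB cosD; ring.
rewrite /fejer_kernel.
move: (\sum_(j < N) cos _) (\sum_(j < N) sin _) HC HS => C S HC HS.
set a := pi * (2 * N%:R - 1) * y in HC HS; set b := pi * y in HC HS *.
have E : 4 * ((C ^+ 2 + S ^+ 2) * sin b ^+ 2) =
   (2 * sin b * C) ^+ 2 + (2 * sin b * S) ^+ 2 by ring.
have E2 : (sin a + sin b) ^+ 2 + (cos b - cos a) ^+ 2 = 2 - 2 * cos (a + b).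
  by rewrite cosD; have := cos2Dsin2 a; have := cos2Dsin2 b; nra.
have := cos_geN1 (a + b).
move: E; rewrite HC HS E2; lra.
Qed.

Lemma fejer_kernelE N (x y : R) : fejer_kernel N (y - x) =
  \sum_(i < N) \sum_(j < N)
     cos (2 * pi * (i%:Z - j%:Z)%:~R * (y - x)).
Proof.
rewrite /fejer_kernel !expr2 !mulr_suml -big_split/=; apply: eq_bigr => i _.
rewrite !mulr_sumr -big_split/=; apply: eq_bigr => j _.
by rewrite -cosB; congr cos; rewrite intrB; ring.
Qed.

Lemma continuous_fejer_kernel N x : continuous (fun y : R => fejer_kernel N (y - x)).
Proof. by rewrite /fejer_kernel; cont. Qed.

Lemma sinDint2pi (x : R) (k : int) : sin (x + 2 * pi * k%:~R) = sin x.
Proof.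
have H n (z : R) : sin (z + 2 * pi * n%:R) = sin z.
  rewrite -[RHS](periodicn (@sinD2pi R) n); congr sin.
  by rewrite -mulr_natr -[pi *+ 2]mulr_natl; ring.
case: k => n; first exact: H.
by rewrite -[LHS](H n.+1) NegzE mulrNz; congr sin; rewrite -pmulrn; ring.
Qed.

Lemma cosDint2pi (x : R) (k : int) : cos (x + 2 * pi * k%:~R) = cos x.
Proof. by rewrite -!sinDpihalf addrAC sinDint2pi. Qed.

Lemma circle_integral_cos (k : int) (x : R) :
  circle_integral (fun y => cos (2 * pi * k%:~R * (y - x))) = (k == 0)%:R.
Proof.
have [->|k0] := eqVneq k 0.
  rewrite -[RHS](circle_integral_cst 1); apply: eq_circle_integral => y _.
  by rewrite mulr0 mul0r cos0.
have c0 : 2 * pi * k%:~R != 0 :> R.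
  by rewrite !mulf_neq0 ?pnatr_eq0 ?intr_eq0// gt_eqF// pi_gt0.
set c := 2 * pi * k%:~R in c0 *.
have dF (y : R) : is_derive y (1 : R) (fun y => c^-1 * sin (c * (y - x))) (cos (c * (y - x))).
   eapply is_derive_val_eq. deriv.
  by rewrite /=; field.
rewrite (circle_integral_derive _ dF); last by cont.
rewrite -(sinDint2pi (c * (0 - x)) k) -/c.
by rewrite (_ : c * (0 - x) + c = c * (1 - x)) ?subrr//; ring.
Qed.

Lemma circle_integral_fejer_kernel N (x : R) :
  circle_integral (fun y => fejer_kernel N (y - x)) = N%:R.
Proof.
under eq_circle_integral do rewrite fejer_kernelE.
rewrite circle_integral_sum; last by move=> i; cont.
under eq_bigr => i _.
  rewrite circle_integral_sum; last by move=> j; cont.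
  under eq_bigr do rewrite circle_integral_cos subr_eq0.
  rewrite (bigD1 i)//= eqxx big1 ?addr0; last first.
    by move=> j ji; rewrite eqz_nat eq_sym -val_eqE in ji *; rewrite (negbTE ji).
  over.
by rewrite sumr_const card_ord.
Qed.

Lemma sin2_lower_bound (a b : R) : 0 < a -> b < 1 -> exists2 e : R, 0 < e &
  forall d, a <= d <= b -> e <= sin (pi * d) ^+ 2.
Proof.
move=> a0 b1; have [ab|ba] := leP a b; last first.
  by exists 1 => // d /andP[ad db]; have := lt_le_trans ba ad; lra.
have [|c Hc Hm] := @EVT_min R (fun d => sin (pi * d) ^+ 2) a b ab.
  by apply: continuous_subspaceT; cont.
exists (sin (pi * c) ^+ 2); last by move=> d Hd; apply: Hm; rewrite in_itv.
move: Hc; rewrite in_itv/= => /andP[ac cb].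
rewrite exprn_gt0// sin_gt0_pi//; have pi0 := pi_gt0 R.
apply/andP; split; first by rewrite mulr_gt0// (lt_le_trans a0).
by rewrite gtr_pMr// (le_lt_trans cb).
Qed.

Definition fourier_abs f (k : int) : R := Num.sqrt (fourier_normsq f k).

(** The integral is the scalar product of the unit vector of angle [c * x] with the pair of Fourier
    coefficients, so this is Cauchy-Schwarz in the plane. *)
Lemma circle_integral_mul_cos_le f (k : int) (x : R) : continuous f ->
  `|circle_integral (fun y => f y * cos (2 * pi * k%:~R * (y - x)))| <= fourier_abs f k.
Proof.
move=> cf; set c := 2 * pi * k%:~R.
have -> : circle_integral (fun y => f y * cos (c * (y - x))) =
    cos (c * x) * fourier_re f k + sin (c * x) * fourier_im f k.
  rewrite -!circle_integralZ; try by cont.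
  rewrite -circle_integralD; try by cont.
  by apply: eq_circle_integral => y _; rewrite mulrBr cosB -/c; ring.
rewrite -sqrtr_sqr ler_sqrt ?addr_ge0 ?sqr_ge0// /fourier_normsq.
set a := fourier_re f k; set b := fourier_im f k.
have := cos2Dsin2 (c * x); move: (cos _) (sin _) => C S H.
have -> : a ^+ 2 + b ^+ 2 = (C ^+ 2 + S ^+ 2) * (a ^+ 2 + b ^+ 2) by rewrite H mul1r.
have := sqr_ge0 (C * b - S * a); lra.
Qed.

Lemma fejer_mean_le f N (x S : R) : continuous f ->
  (forall i : 'I_N, \sum_(j < N) fourier_abs f (i%:Z - j%:Z) <= S) ->
  `|circle_integral (fun y => f y * fejer_kernel N (y - x))| <= N%:R * S.
Proof.
move=> cf HS.
have -> : circle_integral (fun y => f y * fejer_kernel N (y - x)) =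
  \sum_(i < N) \sum_(j < N)
     circle_integral (fun y => f y * cos (2 * pi * (i%:Z - j%:Z)%:~R * (y - x))).
  transitivity (circle_integral (fun y => \sum_(i < N) \sum_(j < N)
     f y * cos (2 * pi * (i%:Z - j%:Z)%:~R * (y - x)))).
    apply: eq_circle_integral => y _; rewrite fejer_kernelE mulr_sumr; apply: eq_bigr => i _.
    by rewrite mulr_sumr.
  rewrite circle_integral_sum; last by move=> i; cont.
  by apply: eq_bigr => i _; rewrite circle_integral_sum//; move=> j; cont.
rewrite (le_trans (ler_norm_sum _ _ _))//.
have -> : N%:R * S = \sum_(i < N) S by rewrite sumr_const card_ord mulr_natl.
apply: ler_sum => i _; rewrite (le_trans (ler_norm_sum _ _ _))// (le_trans _ (HS i))//.
by apply: ler_sum => j _; exact: circle_integral_mul_cos_le.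
Qed.

Lemma periodic1_int f (x : R) (k : int) : periodic1 f -> f (x + k%:~R) = f x.
Proof.
move=> pf; have H n (z : R) : f (z + n%:R) = f z.
  by elim: n z => [|n IH] z; rewrite ?addr0// -natr1 addrA pf.
case: k => n; first exact: H.
by rewrite -[LHS](H n.+1) NegzE mulrNz; congr f; rewrite -pmulrn; ring.
Qed.

Lemma norm_bounded_segment f (a b : R) : continuous f ->
  exists2 M : R, 0 <= M & forall x, a <= x <= b -> `|f x| <= M.
Proof.
move=> cf; have [ab|ba] := leP a b; last first.
  by exists 0 => // x /andP[ax xb]; have := lt_le_trans ba ax; lra.
have [|c Hc Hm] := @EVT_max R (fun d => `|f d|) a b ab.
  by apply: continuous_subspaceT; cont.
by exists `|f c| => // x Hx; apply: Hm; rewrite in_itv.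
Qed.

Lemma continuousP_at (f : R -> R) (x e : R) : {for x, continuous f} -> 0 < e ->
  exists2 d, 0 < d & forall y, `|y - x| < d -> `|f y - f x| < e.
Proof.
move=> cf e0; have /cvgrPdist_lt/(_ _ e0) := cf.
move=> /nbhs_ballP[d /= d0 H]; exists d => // y yx.
rewrite distrC; apply: H; rewrite /ball/= distrC//.
Qed.

(* The hypothesis bounds the sum of all [|f^(k)|], in the form in which Fejer means use it. *)
Lemma norm_le_fourier f (S : R) : continuous f -> periodic1 f ->
  (forall N (i : 'I_N), \sum_(j < N) fourier_abs f (i%:Z - j%:Z) <= S) ->
  forall x, `|f x| <= S.
Proof.
move=> cf pf HS.
have main x : 0 < x < 1 -> `|f x| <= S.
  move=> /andP[x0 x1]; apply/ler_addgt0Pr => e e0.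
  have e20 : 0 < e / 2 by lra.
  have [d d0 Hd] := continuousP_at (cf x) e20.
  have [M M0 HM] := norm_bounded_segment 0 1 cf.
  (* A point of [[0, 1]] at distance at least [d] from the interior point [x] is at distance at most
     [max x (1 - x) < 1], so the squared sine stays above some [s] there. Then [M'] is such that
     [M' * s] equals [2 * M], a bound for the oscillation of [f]. *)
  have [||s s0 Hs] := @sin2_lower_bound d (Num.max x (1 - x)) => //.
    by rewrite gt_max; apply/andP; split; lra.
  pose M' := 2 * M / s.
  have M'0 : 0 <= M' by rewrite divr_ge0 ?mulr_ge0 ?(ltW s0).
  have Hf y : 0 <= y <= 1 -> `|f x - f y| <= e / 2 + M' * sin (pi * (y - x)) ^+ 2.
    move=> Hy; have [yx|yx] := ltP `|y - x| d.
      by rewrite distrC (le_trans (ltW (Hd _ yx)))// lerDl mulr_ge0 ?sqr_ge0.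
    have : s <= sin (pi * (y - x)) ^+ 2.
      have -> : sin (pi * (y - x)) ^+ 2 = sin (pi * `|y - x|) ^+ 2.
        by case: (ger0P (y - x)) => // _; rewrite mulrN sinN sqrrN.
      apply: Hs; rewrite yx/= le_max; case: (ger0P (y - x)) => _; apply/orP; [right|left]; lra.
    move=> H; have -> : e / 2 + M' * sin (pi * (y - x)) ^+ 2 =
       e / 2 + M' * s + M' * (sin (pi * (y - x)) ^+ 2 - s) by ring.
    have -> : M' * s = 2 * M by rewrite /M' divfK// gt_eqF.
    have h1 : `|f y| <= M by apply: HM.
    have h2 : `|f x| <= M by apply: HM; lra.
    have h3 := ler_normB (f x) (f y).
    have h4 : 0 <= M' * (sin (pi * (y - x)) ^+ 2 - s) by rewrite mulr_ge0 ?subr_ge0.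
    lra.
  (* Against the kernel, [e / 2] contributes [e / 2 * N], but the sine term at most [M'], uniformly
     in [N]. Division by a large [N] leaves [S + e]. *)
  have HN N : N%:R * `|f x| <= N%:R * S + (e / 2 * N%:R + M').
    have cK := @continuous_fejer_kernel N x.
    rewrite -{1}(circle_integral_fejer_kernel N x) mulrC.
    have -> : `|f x| * circle_integral (fun y => fejer_kernel N (y - x)) =
       `|circle_integral (fun y => f y * fejer_kernel N (y - x)) +
        circle_integral (fun y => (f x - f y) * fejer_kernel N (y - x))|.
      rewrite -circle_integralD; try by cont.
      rewrite [in RHS](@eq_circle_integral _ _ (fun y => f x * fejer_kernel N (y - x)));
        last by move=> y _; ring.
      rewrite circle_integralZ// normrM; congr (_ * _).
      by rewrite circle_integral_fejer_kernel normr_nat.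
    apply: (le_trans (ler_normD _ _)); apply: lerD; first exact: fejer_mean_le.
    apply: (le_trans (le_norm_circle_integral _)); first by cont.
    rewrite -(circle_integral_fejer_kernel N x) -circle_integralZ//.
    rewrite -[M' in leRHS]circle_integral_cst -circle_integralD; try by cont.
    apply: le_circle_integral; try by cont.
    move=> y Hy; rewrite normrM (ger0_norm (fejer_kernel_ge0 _ _)).
    apply: (@le_trans _ _ ((e / 2 + M' * sin (pi * (y - x)) ^+ 2) * fejer_kernel N (y - x))).
      by rewrite ler_wpM2r ?fejer_kernel_ge0// Hf.
    rewrite mulrDl lerD2l -[leRHS]mulr1 -mulrA ler_wpM2l// mulrC.
    exact: fejer_kernel_sin2_le.
  pose N := (Num.trunc (M' / (e / 2))).+1.
  have N0 : 0 < N%:R :> R by rewrite ltr0n.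
  have HM' : M' <= e / 2 * N%:R.
    by rewrite mulrC -ler_pdivrMr// ltW// truncnS_gt.
  rewrite -(ler_pM2l N0) (le_trans (HN N))//; lra.
(* Periodicity reduces to [[0, 1[]. The point 0 is excluded from [main], because the kernel centred
   there also concentrates at the other end of the period; it is reached as a limit of interior
   points. *)
move=> x; rewrite -(subrK (Num.floor x)%:~R x) periodic1_int//.
set z := x - _.
have [z0 z1] : 0 <= z /\ z < 1.
  by rewrite /z; have := floor_itv x; rewrite intrD => /andP[]; lra.
move: z0; rewrite le_eqVlt => /orP[/eqP<-|z0]; last by rewrite main// z0.
apply/ler_addgt0Pr => e e0.
have [d d0 Hd] := continuousP_at (cf 0) e0.
pose m := Num.min (d / 2) (1 / 2).
have [m0 m1 md] : [/\ 0 < m, m < 1 & m < d].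
  rewrite /m !gt_min lt_min; split; [apply/andP; split|apply/orP; right|apply/orP; left]; lra.
have := Hd m; rewrite subr0 gtr0_norm// => /(_ md) H1.
have := main m; rewrite m0 m1 => /(_ isT) H2.
have : f 0 = f m - (f m - f 0) by ring.
by move=> ->; rewrite (le_trans (ler_normB _ _))// lerD// ltW.
Qed.

End fejer.

(** * Sobolev embedding *)

Section sobolev_embedding.
Context {R : realType}.
Implicit Types (f g : R -> R) (k : int).

(** Finite families of distinct frequencies replace the extended-real sum of [sobolev_norm], so that
    the estimates take place in [R]. *)
Definition sobolev_le (s : R) f (e : R) : Prop := forall r : seq int, uniq r ->
  \sum_(k <- r) (1 + k%:~R ^+ 2) `^ s * fourier_normsq f k <= e ^+ 2.

Lemma fourier_normsq_ge0 f k : 0 <= fourier_normsq f k.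
Proof. by rewrite addr_ge0 ?sqr_ge0. Qed.

Lemma sobolev_norm_le (s e : R) f : 0 <= e ->
  (sobolev_norm s f <= e%:E)%E -> sobolev_le s f e.
Proof.
move=> e0 H r ur; rewrite -lee_fin.
set a := fun k : int => ((1 + k%:~R ^+ 2) `^ s * fourier_normsq f k)%:E.
have a0 k : (0 <= a k)%E by rewrite lee_fin mulr_ge0 ?powR_ge0 ?fourier_normsq_ge0.
apply: (@le_trans _ _ (\esum_(k in [set: int]) a k)).
  apply: esum_ge; exists [set` r].
    by split => //; exact: finite_seq.
  by rewrite -fsbig_seq// sumEFin.
have S0 : (0 <= \esum_(k in [set: int]) a k)%E by exact: esum_ge0.
rewrite -(sqr_sqrte S0) EFin_expe.
by rewrite lee_sqr// ?lee_fin// sqrte_ge0.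
Qed.

Let w (n : nat) (s : R) : R := (1 + n%:R ^+ 2) `^ (- s).

(** This compares [(n+2)^(-2s)] with the integral of [x^(-2s)] over the preceding unit interval,
    without integrals: it combines [1/(n+2) <= ln (n+2) - ln (n+1)] with [1 + x <= expR x]. *)
Lemma weight_telescope (s : R) (n : nat) : 1 / 2 < s ->
  w n.+2 s <= (n.+1%:R `^ (- (2 * s - 1)) - n.+2%:R `^ (- (2 * s - 1))) / (2 * s - 1).
Proof.
move=> hs; have e0 : 0 < 2 * s - 1 by lra.
set e := 2 * s - 1 in e0 *.
rewrite ler_pdivlMr//.
have p1 : 0 < n.+1%:R :> R by rewrite ltr0n.
have p2 : 0 < n.+2%:R :> R by rewrite ltr0n.
apply: (@le_trans _ _ (n.+2%:R `^ (- e) * (n.+2%:R^-1 * e))).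
  rewrite mulrA ler_pM2r//.
  have -> : n.+2%:R `^ (- e) * n.+2%:R^-1 = (n.+2%:R ^+ 2) `^ (- s) :> R.
    rewrite -powR_mulrn ?ltW// -powRrM -[X in _ * X]powR_inv1 ?ltW// -powRD.
      by congr (_ `^ _); rewrite /e; lra.
    by apply/implyP => _; rewrite gt_eqF.
  rewrite /w !powRN lef_pV2 ?posrE ?powR_gt0 ?exprn_gt0 ?addr_gt0 ?exprn_gt0//.
  by rewrite ge0_ler_powR ?nnegrE ?addr_ge0 ?sqr_ge0//; lra.
have hl : n.+2%:R^-1 <= ln n.+2%:R - ln n.+1%:R :> R.
  rewrite -opprB lerNr -ln_div ?posrE//.
  have -> : n.+1%:R / n.+2%:R = 1 + (- n.+2%:R^-1) :> R.
    by rewrite -[in n.+1%:R](addrK 1 n.+1%:R) natr1 mulrBl divff ?mul1r// gt_eqF.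
  by rewrite le_ln1Dx// ltrN2 invf_lt1// ltr1n.
have -> : n.+1%:R `^ (- e) = n.+2%:R `^ (- e) * expR (e * (ln n.+2%:R - ln n.+1%:R)) :> R.
  by rewrite /powR !gt_eqF// -expRD; congr expR; ring.
rewrite -[X in _ <= _ - X]mulr1 -mulrBr ler_pM2l ?powR_gt0//.
have := expR_ge1Dx (e * (ln n.+2%:R - ln n.+1%:R)).
have : n.+2%:R^-1 * e <= e * (ln n.+2%:R - ln n.+1%:R) by rewrite mulrC ler_pM2l.
move: (n.+2%:R^-1 * e) (e * (_ - _)) => *; lra.
Qed.

Lemma weight_ge0 n s : 0 <= w n s. Proof. exact: powR_ge0. Qed.

Lemma weight_le1 n (s : R) : 0 <= s -> w n s <= 1.
Proof.
move=> s0; rewrite /w powRN invf_le1 ?powR_gt0 ?ltr_pwDl ?sqr_ge0//.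
have := @ge0_ler_powR R s s0 1 (1 + n%:R ^+ 2); rewrite powR1; apply; rewrite ?nnegrE ?addr_ge0 ?sqr_ge0//.
by rewrite lerDl sqr_ge0.
Qed.

(** The first two terms are at most 1 each and the others telescope; passing to [n.+2] terms ensures
    that both are present. *)
Lemma weight_sum_le (s : R) (n : nat) : 1 / 2 < s ->
  \sum_(i < n) w i s <= 2 + (2 * s - 1)^-1.
Proof.
move=> hs; have e0 : 0 < 2 * s - 1 by lra.
have H m : \sum_(i < m.+2) w i s <=
    2 + (1 - m.+1%:R `^ (- (2 * s - 1))) / (2 * s - 1).
  elim: m => [|m IH].
    rewrite !big_ord_recl big_ord0 powR1 subrr mul0r addr0/=.
    by have := @weight_le1 0 s; have := @weight_le1 1 s; lra.
  rewrite big_ord_recr/=; apply: (le_trans (lerD IH (weight_telescope m hs))).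
  by rewrite -addrA lerD2l -mulrDl ler_pM2r ?invr_gt0//; lra.
apply: (@le_trans _ _ (\sum_(i < n.+2) w i s)).
  by rewrite !big_ord_recr/= -addrA lerDl addr_ge0// weight_ge0.
apply: (le_trans (H n)); rewrite lerD2l -[leRHS]mul1r ler_pM2r ?invr_gt0// gerBl powR_ge0.
Qed.

(** Row [i] is cut just after the diagonal. On each side the distances [|i - j|] are distinct, so
    each half is dominated by a sum of [weight_sum_le]; the right half misses the distance 0, whose
    term is added. *)
Lemma weight_conv_sum_le (s : R) (N : nat) (i : 'I_N) : 1 / 2 < s ->
  \sum_(j < N) (1 + ((i%:Z - j%:Z)%:~R : R) ^+ 2) `^ (- s) <= 4 + 2 / (2 * s - 1).
Proof.
move=> hs.
have sq (a b : nat) : (b <= a)%N -> (((a%:Z - b%:Z)%:~R : R) ^+ 2 = ((a - b)%N%:R) ^+ 2)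
                          * (((b%:Z - a%:Z)%:~R : R) ^+ 2 = ((a - b)%N%:R) ^+ 2).
  by move=> ba; rewrite -(opprB a%:Z) mulrNz sqrrN subzn// -pmulrn.
rewrite -(big_mkord xpredT (fun j => (1 + ((i%:Z - j%:Z)%:~R : R) ^+ 2) `^ (- s))).
rewrite (@big_cat_nat _ _ _ i.+1)//=.
have -> : 4 + 2 / (2 * s - 1) = (2 + (2 * s - 1)^-1) + (2 + (2 * s - 1)^-1) by lra.
apply: lerD.
  apply: le_trans (weight_sum_le i.+1 hs).
  rewrite big_nat_rev/= -(big_mkord xpredT (fun j => w j s)) le_eqVlt; apply/orP; left; apply/eqP.
  apply: eq_big_nat => j /andP[_ ji]; rewrite add0n subSS /w sq; last by rewrite leq_subr.
  by rewrite subKn.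
apply: le_trans (weight_sum_le (N - i.+1).+1 hs).
rewrite big_ord_recl/= -[leLHS]add0r lerD ?weight_ge0//.
rewrite -{1}[i.+1]add0n big_addn big_mkord le_eqVlt; apply/orP; left; apply/eqP.
apply: eq_bigr => j _; rewrite /w (sq (j + i.+1)%N i _).2; last by rewrite (leq_trans (leqnSn i)) ?leq_addl.
by rewrite addnS subSn ?leq_addl// addnK /bump leq0n add1n.
Qed.

(** The moduli of the Fourier coefficients are summed by Cauchy-Schwarz, in the form of an
    arithmetic-geometric inequality weighted by [e], which makes the outcome linear in [e]. Within a
    row the frequencies [i - j] are distinct, as [sobolev_le] requires. *)
Lemma sobolev_embedding (s : R) : 1 / 2 < s -> exists2 C : R, 0 < C &
  forall f e, continuous f -> periodic1 f -> 0 < e -> sobolev_le s f e ->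
    forall x, `|f x| <= C * e.
Proof.
move=> hs; pose Z := 4 + 2 / (2 * s - 1).
have Z0 : 0 < Z by rewrite /Z addr_gt0// divr_gt0//; lra.
exists ((Z + 1) / 2); first by lra.
move=> f e cf pf e0 H; apply: norm_le_fourier => // N i.
pose W (k : int) : R := (1 + k%:~R ^+ 2) `^ (- s).
have W0 k : 0 < W k by rewrite /W powR_gt0// ltr_pwDl ?sqr_ge0.
have amgm k : fourier_abs f k <= (e * W k + (1 + k%:~R ^+ 2) `^ s * fourier_normsq f k / e) / 2.
  have -> : (1 + k%:~R ^+ 2) `^ s = (W k)^-1 by rewrite /W powRN invrK.
  rewrite -(sqr_sqrtr (fourier_normsq_ge0 f k)) -/(fourier_abs f k).
  set a := fourier_abs f k; have p := W0 k.
  have -> : (e * W k + (W k)^-1 * a ^+ 2 / e) / 2 =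
     a + (e * W k - a) ^+ 2 / (2 * (e * W k)).
    by field; rewrite !gt_eqF.
  by rewrite lerDl divr_ge0 ?sqr_ge0// !mulr_ge0// ltW.
apply: le_trans; first by apply: ler_sum => j _; exact: amgm.
rewrite -mulr_suml mulrAC ler_pM2r//.
rewrite big_split/= -mulr_sumr -mulr_suml mulrDl mul1r mulrC lerD//.
  by rewrite ler_pM2r//; exact: weight_conv_sum_le.
rewrite ler_pdivrMr// -expr2.
have := H (map (fun j : 'I_N => i%:Z - j%:Z) (index_enum _)).
rewrite big_map; apply.
rewrite map_inj_uniq ?index_enum_uniq// => j j' /addrI/oppr_inj[]; exact: val_inj.
Qed.


(** Integration by parts; the boundary terms cancel since [f] and the trigonometric factor take
    equal values at 0 and 1. *)
Lemma fourier_re_derive f g k : periodic1 f -> continuous g ->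
  (forall x, is_derive x (1 : R) f (g x)) ->
  fourier_re g k = 2 * pi * k%:~R * fourier_im f k.
Proof.
move=> pf cg df; rewrite /fourier_re /fourier_im; set c := 2 * pi * k%:~R.
have cf : continuous f by move=> x; exact: is_derive_cont (df x).
have dF (x : R) : is_derive x (1 : R) (fun x => f x * cos (c * x))
    (g x * cos (c * x) - c * (f x * sin (c * x))).
  have dfx := df x; eapply is_derive_val_eq. deriv.
  by rewrite /=; ring.
have := circle_integral_derive _ dF; rewrite circle_integralB; try by cont.
rewrite circle_integralZ; last by cont.
have f10 : f 1 = f 0 by rewrite -(pf 0) add0r.
rewrite f10 mulr1 mulr0 -[c]add0r cosDint2pi add0r subrr => H.
by apply/eqP; rewrite -subr_eq0; apply/eqP; apply: H; cont.
Qed.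

Lemma fourier_im_derive f g k : periodic1 f -> continuous g ->
  (forall x, is_derive x (1 : R) f (g x)) ->
  fourier_im g k = - (2 * pi * k%:~R * fourier_re f k).
Proof.
move=> pf cg df; rewrite /fourier_re /fourier_im; set c := 2 * pi * k%:~R.
have cf : continuous f by move=> x; exact: is_derive_cont (df x).
have dF (x : R) : is_derive x (1 : R) (fun x => f x * sin (c * x))
    (g x * sin (c * x) + c * (f x * cos (c * x))).
  have dfx := df x; eapply is_derive_val_eq. deriv.
  by rewrite /=; ring.
have := circle_integral_derive _ dF; rewrite circle_integralD; try by cont.
rewrite circle_integralZ; last by cont.
have f10 : f 1 = f 0 by rewrite -(pf 0) add0r.
rewrite f10 mulr1 mulr0 -[c]add0r sinDint2pi add0r subrr => H.
by apply/eqP; rewrite -addr_eq0; apply/eqP; apply: H; cont.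
Qed.

(** Each coefficient is multiplied by [2 pi k] in modulus, and [k^2 <= 1 + k^2] pays for one order;
    the factor [2 pi] remains because the weight of the norm does not contain it. *)
Lemma sobolev_le_derive (s e : R) f g : periodic1 f -> continuous g ->
  (forall x, is_derive x (1 : R) f (g x)) ->
  sobolev_le s f e -> sobolev_le (s - 1) g (2 * pi * e).
Proof.
move=> pf cg df H r ur; rewrite exprMn.
apply: le_trans (ler_wpM2l (sqr_ge0 _) (H r ur)); rewrite mulr_sumr.
apply: ler_sum => k _.
rewrite /fourier_normsq (fourier_re_derive _ pf cg df) (fourier_im_derive _ pf cg df).
set a := fourier_re f k; set b := fourier_im f k; set x := k%:~R.
have x1 : 0 < 1 + x ^+ 2 by rewrite ltr_pwDl ?sqr_ge0.
have -> : (1 + x ^+ 2) `^ s = (1 + x ^+ 2) * (1 + x ^+ 2) `^ (s - 1).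
  rewrite -{2}[1 + x ^+ 2]powRr1 ?ltW// -powRD; last by apply/implyP => _; rewrite gt_eqF.
  by congr (_ `^ _); ring.
have p := powR_ge0 (1 + x ^+ 2) (s - 1).
set p1 := _ `^ (s - 1) in p *.
have -> : (2 * pi) ^+ 2 * ((1 + x ^+ 2) * p1 * (a ^+ 2 + b ^+ 2)) =
  p1 * ((2 * pi * x * b) ^+ 2 + (- (2 * pi * x * a)) ^+ 2)
   + (2 * pi) ^+ 2 * (p1 * (a ^+ 2 + b ^+ 2)) by ring.
by rewrite lerDl mulr_ge0 ?sqr_ge0// mulr_ge0// addr_ge0 ?sqr_ge0.
Qed.

Lemma sobolev_norm_ae (s : R) f g : measurable_fun [set: R] f -> measurable_fun [set: R] g ->
  {ae lebesgue_measure, forall x : R, f x = g x} -> sobolev_norm s f = sobolev_norm s g.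
Proof.
move=> mf mg fg.
have H (h : R -> R) : continuous h ->
    circle_integral (fun x => f x * h x) = circle_integral (fun x => g x * h x).
  move=> ch; rewrite /circle_integral /Rintegral; congr fine.
  have mh : measurable_fun [set: R] h by exact: continuous_measurable_fun.
  apply: ae_eq_integral => //.
  - by apply/measurable_EFinP; apply: measurable_funM => //; exact: measurable_funTS.
  - by apply/measurable_EFinP; apply: measurable_funM => //; exact: measurable_funTS.
  - case: fg => A [mA A0 HA]; exists A; split => // x /= Hx; apply: HA => /= E.
    by apply: Hx => _; rewrite E.
rewrite /sobolev_norm; congr sqrte; apply: eq_esum => k _.
rewrite /fourier_normsq /fourier_re /fourier_im !H//; by cont.
Qed.

Lemma near_sobolev_norm_le {T : Type} {F : set_system T} {FF : Filter F}
    (phi : T -> \bar R) (e : R) : 0 < e -> phi r @[r --> F] --> 0%E ->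
  \forall r \near F, (phi r <= e%:E)%E.
Proof.
move=> e0 /fine_cvgP[fin /cvgrPdist_lt/(_ _ e0) H].
near=> r.
have fr : phi r \is a fin_num by near: r.
rewrite -(fineK fr) lee_fin (le_trans (ler_norm _))// ltW//.
by rewrite -normrN -[X in `|X|]add0r; near: r.
Unshelve. all: by end_near. Qed.

End sobolev_embedding.

(** * Primitives *)

Lemma integrable_setU_disjoint d (T : measurableType d) (R : realType)
    (mu : {measure set T -> \bar R}) (A B : set T) (f : T -> \bar R) :
  measurable A -> measurable B -> (forall x, A x -> ~ B x) ->
  mu.-integrable A f -> mu.-integrable B f -> mu.-integrable (A `|` B) f.
Proof.
move=> mA mB AB /(integrable_mkcond f mA) iA /(integrable_mkcond f mB) iB.
apply/(integrable_mkcond f (measurableU _ _ mA mB)).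
have -> : f \_ (A `|` B) = ((f \_ A) \+ (f \_ B))%E.
  apply/funext => x; rewrite !patchE in_setU.
  have [|_] := boolP (x \in A); last by rewrite add0e.
  by rewrite inE => /AB; rewrite -notin_setE => /negbTE ->; rewrite adde0.
exact: integrableD.
Qed.

Section primitive.
Context {R : realType}.
Implicit Types (f g h : R -> R).

Lemma Rintegral_chasles h (a b c : R) : continuous h -> a <= b -> b <= c ->
  \int[lebesgue_measure]_(x in `[a, c]) h x =
  \int[lebesgue_measure]_(x in `[a, b]) h x + \int[lebesgue_measure]_(x in `[b, c]) h x.
Proof.
move=> ch ab bc; have ci := @cont_integrable _ h _ _ ch.
have := @Rintegral_itvB _ h (BLeft a) (BRight c) b (ci a c).
rewrite !bnd_simp => /(_ ab bc); rewrite Rintegral_itv_obnd_cbnd.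
  by move=> <-; rewrite addrC subrK.
by apply: integrableS (ci b c) => //; apply: subset_itvr; rewrite bnd_simp.
Qed.

Lemma exists_primitive h : continuous h ->
  exists2 H : R -> R, H 0 = 0 & forall x, is_derive x (1 : R) H (h x).
Proof.
move=> ch.
pose F (a x : R) := \int[lebesgue_measure]_(y in `[a, x]) h y.
(* The base point moves with [x], to cover the whole line with one formula. *)
pose H x := F (- `|x| - 1) x - F (- `|x| - 1) 0.
have HE a x : a <= - `|x| - 1 -> H x = F a x - F a 0.
  move=> ax; have := ler_norm (- x); have := normr_ge0 x; rewrite normrN => *.
  rewrite /H /F (@Rintegral_chasles h a (- `|x| - 1) x)//; last by lra.
  rewrite (@Rintegral_chasles h a (- `|x| - 1) 0)//; last by lra.
exists H => [|x]; first by rewrite /H subrr.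
(* For [|y - x| < 1] the moving base point [- |y| - 1] lies to the right of this fixed one, so near
   [x] the function [H] is the integral from [a], up to a constant. *)
pose a := - `|x| - 2.
have nE : \forall y \near x, (fun y => F a y - F a 0) y = H y.
  near=> y; rewrite -HE// /a.
  have : `|y - x| < 1.
    by near: y; apply/nbhs_ballP; exists 1 => //= z; rewrite /ball/= distrC.
  by have := ler_normD (y - x) x; rewrite subrK; lra.
apply: (near_eq_is_derive nE).
have ax : a < x by have := ler_norm (- x); have := normr_ge0 x; rewrite normrN /a; lra.
have [||dF FE] := @continuous_FTC1_closed _ h a x (x + 1) _ _ ax (ch x).
- by rewrite ltrDl.
- exact: cont_integrable.
have dFx : is_derive x (1 : R) (F a) (h x).
  by split; [exact: dF|rewrite -derive1E; exact: FE].
rewrite -[h x]subr0; exact: (is_deriveB1 dFx (is_deriveC1 _ _)).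
Unshelve. all: by end_near. Qed.

Lemma Rintegral_primitive h H (a b : R) : continuous h ->
  (forall x, is_derive x (1 : R) H (h x)) -> a <= b ->
  \int[lebesgue_measure]_(x in `[a, b]) h x = H b - H a.
Proof.
move=> ch dH; rewrite le_eqVlt => /orP[/eqP<-|ab].
  by rewrite set_itv1 Rintegral_set1 subrr.
rewrite /Rintegral (@continuous_FTC2 _ h H a b)//.
- exact: continuous_subspaceT.
- have cF : continuous H by move=> x; exact: is_derive_cont (dH x).
  split => [x _||]; first by case: (dH x).
    exact/cvg_at_right_filter/cF.
  exact/cvg_at_left_filter/cF.
- by move=> x _; rewrite (is_derive_derive1 (dH x)).
Qed.

(** Meant for the convolution integrand, which has one formula on each side of [b]. At [b] itself
    only [f] is prescribed: a single point is negligible. *)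
Lemma Rintegral_glue f g h (a b c : R) : continuous f -> continuous g -> a <= b -> b <= c ->
  (forall x, a <= x <= b -> h x = f x) -> (forall x, b < x <= c -> h x = g x) ->
  \int[lebesgue_measure]_(x in `[a, c]) h x =
  \int[lebesgue_measure]_(x in `[a, b]) f x + \int[lebesgue_measure]_(x in `[b, c]) g x.
Proof.
move=> cf cg ab bc hf hg.
have i1 : lebesgue_measure.-integrable `[a, b] (EFin \o h).
  have := cont_integrable a b cf; apply: eq_integrable => // x.
  by rewrite inE/= in_itv/= => /hf ->.
have gS : lebesgue_measure.-integrable `]b, c] (EFin \o g).
  by apply: integrableS (cont_integrable b c cg) => //; apply: subset_itvr; rewrite bnd_simp.
have i2 : lebesgue_measure.-integrable `]b, c] (EFin \o h).
  by move: gS; apply: eq_integrable => // x; rewrite inE/= in_itv/= => /hg ->.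
have i3 : lebesgue_measure.-integrable `[a, c] (EFin \o h).
  rewrite (@itv_bndbnd_setU _ _ _ (BRight b)) ?bnd_simp//.
  apply: integrable_setU_disjoint => // x /=; rewrite !in_itv/= => /andP[_ xb].
  by rewrite ltNge xb.
have := @Rintegral_itvB _ h (BLeft a) (BRight c) b i3; rewrite !bnd_simp => /(_ ab bc).
move=> /(canRL (subrK _)) ->; rewrite addrC; congr (_ + _).
  by apply: eq_Rintegral => x; rewrite inE/= in_itv/= => /hf.
rewrite -(Rintegral_itv_obnd_cbnd gS).
by apply: eq_Rintegral => x; rewrite inE/= in_itv/= => /hg.
Qed.

End primitive.

(** * Convolution with the kernel *)

Section kernel.
Context {R : realType}.
Implicit Types (f g h X Y : R -> R).

(** From [expR (- (1 / 2)) >= 1 - 1 / 2]. This crude value is good enough for [beta], see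
    [beta_le]. *)
Lemma expR1_le4 : expR 1 <= 4 :> R.
Proof.
have h := @expR_ge1Dx R (- (1 / 2)).
have p : 0 < expR (1 / 2) :> R := expR_gt0 _.
have E : expR 1 = expR (1 / 2) * expR (1 / 2) :> R by rewrite -expRD; congr expR; lra.
have E2 : expR (1 / 2) * expR (- (1 / 2)) = 1 :> R by rewrite -expRD subrr expR0.
rewrite E; nra.
Qed.

(* [X] and [Y] are the two halves of [p * g]: [(p * g)' = X - Y]. *)
Definition kernel_halves g X Y : Prop :=
  [/\ periodic1 X, periodic1 Y,
      forall x, is_derive x (1 : R) X (X x - g x / 2) &
      forall x, is_derive x (1 : R) Y (- Y x + g x / 2)].

Lemma derive_ge0_leT (f df : R -> R) (a b : R) : a <= b ->
  (forall x, is_derive x (1 : R) f (df x)) ->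
  (forall x, a < x < b -> 0 <= df x) -> f a <= f b.
Proof.
move=> ab dF H; apply: (derive_ge0_le ab _ (fun x _ => dF x) H).
by apply: continuous_subspaceT => x; exact: is_derive_cont (dF x).
Qed.

(** Integrating factors turn the two equations into [P] and [Q], and periodicity closes them over
    one period: [(1 - 1/e) X x] and [(e - 1) Y x] are the integrals over [0 <= t <= 1] of
    [g (x + t) / 2] with weights [expR (- t)] and [expR t]. The comparison
    [expR (- t) <= expR t <= expR (2 - t)] of the weights yields [X <= e Y] and [Y <= e X]. *)
Lemma kernel_halves_bounds g X Y : kernel_halves g X Y -> (forall x, 0 <= g x) ->
  forall x, [/\ 0 <= X x, 0 <= Y x, Y x <= 4 * X x & X x <= 4 * Y x].
Proof.
move=> [pX pY dX dY] g0 x.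
pose P y := expR (x - y) * X y; pose Q y := expR (y - x) * Y y.
have dP y : is_derive y (1 : R) P (- (expR (x - y) * g y / 2)).
  have dXy := dX y; eapply is_derive_val_eq; first by rewrite /P; deriv.
  by rewrite /=; ring.
have dQ y : is_derive y (1 : R) Q (expR (y - x) * g y / 2).
  have dYy := dY y; eapply is_derive_val_eq; first by rewrite /Q; deriv.
  by rewrite /=; ring.
have x1 : x <= x + 1 by lra.
have e0 : 0 < expR (-1) :> R := expR_gt0 _.
have e1 : expR (-1) < 1 :> R by rewrite expR_lt1; lra.
have ee : expR 1 * expR (-1) = 1 :> R by rewrite -expRD subrr expR0.
have Px : P x = X x by rewrite /P subrr expR0 mul1r.
have Qx : Q x = Y x by rewrite /Q subrr expR0 mul1r.
have Px1 : P (x + 1) = expR (-1) * X x by rewrite /P pX; congr (expR _ * _); ring.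
have Qx1 : Q (x + 1) = expR 1 * Y x by rewrite /Q pY; congr (expR _ * _); ring.
have X0 : 0 <= X x.
  have : - P x <= - P (x + 1).
    apply: (derive_ge0_leT x1 (fun y => is_derive_N1 (dP y))) => y _.
    by rewrite opprK !mulr_ge0// expR_ge0.
  by rewrite Px Px1; nra.
have Y0 : 0 <= Y x.
  have : Q x <= Q (x + 1).
    by apply: (derive_ge0_leT x1 dQ) => y _; rewrite !mulr_ge0// expR_ge0.
  by rewrite Qx Qx1; nra.
have e4 := expR1_le4.
have XY : X x <= expR 1 * Y x.
  have : P x + Q x <= P (x + 1) + Q (x + 1).
    apply: (derive_ge0_leT x1 (fun y => is_deriveD1 (dP y) (dQ y))) => y /andP[xy yx].
    have : expR (x - y) <= expR (y - x) by rewrite ler_expR; lra.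
    have := g0 y; move: (g y) (expR _) (expR _) => *; nra.
  rewrite Px Qx Px1 Qx1; nra.
have YX : Y x <= expR 1 * X x.
  have : - (Q x + expR 2 * P x) <= - (Q (x + 1) + expR 2 * P (x + 1)).
    pose D y := - (Q y + expR 2 * P y).
    have dD y : is_derive y (1 : R) D ((expR 2 * expR (x - y) - expR (y - x)) * (g y / 2)).
      have dPy := dP y; have dQy := dQ y; eapply is_derive_val_eq; first by rewrite /D; deriv.
      by rewrite /=; ring.
    apply: (derive_ge0_leT x1 dD) => y /andP[xy yx].
    rewrite mulr_ge0 ?divr_ge0// subr_ge0 -expRD ler_expR; lra.
  have e2 : expR 2 = expR 1 * expR 1 :> R by rewrite -expRD; congr expR; lra.
  rewrite Px Qx Px1 Qx1 e2.
  have -> : expR 1 * expR 1 * (expR (-1) * X x) = expR 1 * X x.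
    transitivity ((expR 1 * expR (-1)) * (expR 1 * X x)); first by ring.
    by rewrite ee mul1r.
  have : 1 < expR 1 :> R by rewrite expR_gt1.
  move: (expR 1) => E *; rewrite -subr_ge0.
  by rewrite -(pmulr_rge0 _ (_ : 0 < E - 1)); lra.
split => //; [apply: (le_trans YX)|apply: (le_trans XY)]; exact: ler_wpM2r.
Qed.

(** The halves of the constant [M] are both [M / 2]; the bound is the positivity of the halves of
    [M - g]. *)
Lemma kernel_halves_le g X Y (M : R) : kernel_halves g X Y -> (forall x, g x <= M) ->
  forall x, X x <= M / 2 /\ Y x <= M / 2.
Proof.
move=> [pX pY dX dY] gM x.
have [||] := @kernel_halves_bounds (fun x => M - g x) (fun x => M / 2 - X x)
    (fun x => M / 2 - Y x) _ _ x; last by rewrite !subr_ge0.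
- split => [y|y|y|y]; rewrite ?pX ?pY//.
  + have dXy := dX y; eapply is_derive_val_eq; first by deriv.
    by rewrite /=; lra.
  + have dYy := dY y; eapply is_derive_val_eq; first by deriv.
    by rewrite /=; lra.
- by move=> y; rewrite subr_ge0.
Qed.

(** Serves to complete the square in the nonlinearity: the derivative [X - Y] of the convolution is
    unaffected. *)
Lemma kernel_halves_shift g X Y (c : R) : kernel_halves g X Y ->
  kernel_halves (fun x => g x + c) (fun x => X x + c / 2) (fun x => Y x + c / 2).
Proof.
move=> [pX pY dX dY]; split => [y|y|y|y]; rewrite ?pX ?pY//.
- have dXy := dX y; eapply is_derive_val_eq; first by deriv.
  by rewrite /=; lra.
- have dYy := dY y; eapply is_derive_val_eq; first by deriv.
  by rewrite /=; lra.
Qed.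

Lemma DP_kernel_periodic : periodic1 (@DP_kernel R).
Proof.
move=> z; rewrite /DP_kernel floorDrz ?rpred1// floor1 intrD.
by congr (cosh _ / _); ring.
Qed.

Lemma DP_kernel_01 (z : R) : 0 <= z < 1 -> DP_kernel z = cosh (z - 1 / 2) / (2 * sinh (1 / 2)).
Proof. by move=> H; rewrite /DP_kernel (@floor_def _ z 0) ?subr0. Qed.

Lemma DP_kernel_N10 (z : R) : -1 <= z < 0 -> DP_kernel z = cosh (z + 1 / 2) / (2 * sinh (1 / 2)).
Proof.
move=> H; rewrite /DP_kernel (@floor_def _ z (-1)) ?addNr//.
by congr (cosh _ / _); lra.
Qed.

Lemma cont_cosh f : continuous f -> continuous (fun x => cosh (f x)).
Proof. by move=> cf; rewrite /cosh; cont. Qed.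

Lemma kernel_halves_exist g : continuous g -> periodic1 g ->
  exists X Y, kernel_halves g X Y /\
    forall x, circle_conv (@DP_kernel R) g x = X x + Y x.
Proof.
move=> cg pg.
have [|E1 E10 dE1] := @exists_primitive R (fun y => expR (- y) * g y); first by cont.
have [|E2 E20 dE2] := @exists_primitive R (fun y => expR y * g y); first by cont.
pose q : R := expR (1 / 2); pose q' : R := expR (- (1 / 2)).
have q0 : 0 < q := expR_gt0 _; have q'0 : 0 < q' := expR_gt0 _.
have qq : q * q' = 1 by rewrite /q /q' -expRD subrr expR0.
have q'q : q' < q by rewrite ltr_expR; lra.
have q1 : expR 1 = q * q by rewrite /q -expRD; congr expR; lra.
have q1' : expR (-1) = q' * q' by rewrite /q' -expRD; congr expR; lra.
have E1p x : E1 (x + 1) = E1 1 + expR (-1) * E1 x.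
  pose D x := E1 (x + 1) - expR (-1) * E1 x.
  have dD y : is_derive y (1 : R) D 0.
    have dy := dE1 y.
    have dy1 : is_derive y (1 : R) (fun y => E1 (y + 1))
        (expR (- (y + 1)) * g (y + 1) * (1 + 0)).
      exact: (@is_derive_comp1 _ E1 (fun y => y + 1) _ _ _ (dE1 _)
        (is_deriveD1 (is_deriveI1 y) (is_deriveC1 1 y))).
    eapply is_derive_val_eq; first by rewrite /D; deriv.
    by rewrite /= pg opprD expRD; ring.
  have := is_derive_0_is_cst x 0 dD.
  by rewrite /D E10 add0r mulr0 subr0 => /(canRL (subrK _)).
have E2p x : E2 (x + 1) = E2 1 + expR 1 * E2 x.
  pose D x := E2 (x + 1) - expR 1 * E2 x.
  have dD y : is_derive y (1 : R) D 0.
    have dy := dE2 y.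
    have dy1 : is_derive y (1 : R) (fun y => E2 (y + 1))
        (expR (y + 1) * g (y + 1) * (1 + 0)).
      exact: (@is_derive_comp1 _ E2 (fun y => y + 1) _ _ _ (dE2 _)
        (is_deriveD1 (is_deriveI1 y) (is_deriveC1 1 y))).
    eapply is_derive_val_eq; first by rewrite /D; deriv.
    by rewrite /= pg expRD; ring.
  have := is_derive_0_is_cst x 0 dD.
  by rewrite /D E20 add0r mulr0 subr0 => /(canRL (subrK _)).
(* With any constant in place of the terms in [E1 1] and [E2 1], the functions below satisfy the two
   differential equations; periodicity forces the factors [K * q = 1 / (2 (1 - 1/e))] and
   [K * q' = 1 / (2 (e - 1))]. *)
pose K := (2 * (q - q'))^-1.
have nK : q - q' != 0 by rewrite gt_eqF// subr_gt0.
pose X x := expR x * (K * q * E1 1 - E1 x / 2).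
pose Y x := expR (- x) * (K * q' * E2 1 + E2 x / 2).
exists X, Y.
have pX : periodic1 X.
  move=> x; rewrite /X E1p expRD q1 q1' -mulrA; congr (_ * _).
  transitivity (q * (q * K * (q * E1 1 - (q - q') * E1 1)) - (q * q') * (q * q') * E1 x / 2).
    by rewrite /K; field.
  rewrite qq.
  transitivity ((q * q') * q * K * E1 1 - E1 x / 2); first by ring.
  by rewrite qq; ring.
have pY : periodic1 Y.
  move=> x; rewrite /Y E2p opprD expRD q1 q1' -mulrA; congr (_ * _).
  transitivity (q' * (q' * K * (q' * E2 1 + (q - q') * E2 1)) + (q * q') * (q * q') * E2 x / 2).
    by rewrite /K; field.
  rewrite qq.
  transitivity ((q * q') * q' * K * E2 1 + E2 x / 2); first by ring.
  by rewrite qq; ring.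
split.
  split => // x.
    have dx := dE1 x; eapply is_derive_val_eq; first by rewrite /X; deriv.
    rewrite /=.
    have := expRxMexpNx_1 x; rewrite /X => H.
    transitivity (expR x * (K * q * E1 1 - E1 x / 2) - (expR x * expR (- x)) * g x / 2); first by ring.
    by rewrite H mul1r.
  have dx := dE2 x; eapply is_derive_val_eq; first by rewrite /Y; deriv.
  rewrite /=.
  have := expRxMexpNx_1 x; rewrite /Y => H.
  transitivity (- (expR (- x) * (K * q' * E2 1 + E2 x / 2)) + (expR x * expR (- x)) * g x / 2); first by ring.
  by rewrite H mul1r.
have pc : periodic1 (circle_conv (@DP_kernel R) g).
  by move=> x; apply: eq_circle_integral => y _; rewrite addrAC DP_kernel_periodic.
have main x : 0 <= x < 1 -> circle_conv (@DP_kernel R) g x = X x + Y x.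
  move=> /andP[x0 x1].
  pose f a y := cosh (x - y + a) / (2 * sinh (1 / 2)) * g y.
  pose F (a y : R) := expR (x + a) / (4 * sinh (1 / 2)) * E1 y + expR (- (x + a)) / (4 * sinh (1 / 2)) * E2 y.
  have s0 : sinh (1 / 2) = (q - q') / 2 :> R by [].
  have dF a y : is_derive y (1 : R) (F a) (f a y).
    have dy1 := dE1 y; have dy2 := dE2 y.
    eapply is_derive_val_eq; first by rewrite /F; deriv.
    rewrite /f /cosh /= s0.
    have -> : x - y + a = (x + a) + (- y) by ring.
    move: (x + a) => P.
    rewrite (opprB P y) !expRD.
    by field.
  have cf a : continuous (f a) by rewrite /f; cont; apply: cont_cosh; cont.
  rewrite /circle_conv /circle_integral.
  (* The argument [x - y] of the kernel lies in [[0, 1[] for [y <= x] and in [[-1, 0[] for [y > x],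
     whence the two shifts. *)
  rewrite (@Rintegral_glue _ (f (- (1 / 2))) (f (1 / 2)) _ 0 x 1 (cf _) (cf _) x0 (ltW x1)); first last.
  - move=> y /andP[xy y1]; rewrite DP_kernel_N10//; lra.
  - move=> y /andP[y0 yx]; rewrite DP_kernel_01//; lra.
  have I1 := Rintegral_primitive (cf (- (1 / 2))) (dF (- (1 / 2))) x0.
  have I2 := Rintegral_primitive (cf (1 / 2)) (dF (1 / 2)) (ltW x1).
  apply: (etrans (congr2 +%R I1 I2)).
  rewrite /F /X /Y E10 E20 s0 !opprD !opprK !expRD -/q -/q' /K.
  by field.
move=> x; rewrite -(subrK (Num.floor x)%:~R x) periodic1_int// main; last first.
  by have := floor_itv x; rewrite intrD => /andP[]; lra.
by rewrite (periodic1_int _ _ pX) (periodic1_int _ _ pY).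
Qed.

End kernel.

(** * The flow of a Lipschitz vector field *)

Section flow.
Context {R : realType}.

Lemma derive_norm_le (f g df dg : R -> R) (t : R) : 0 <= t ->
  (forall x, is_derive x (1 : R) f (df x)) -> (forall x, is_derive x (1 : R) g (dg x)) ->
  `|f 0| <= g 0 -> (forall x, 0 < x < t -> `|df x| <= dg x) -> `|f t| <= g t.
Proof.
move=> t0 dF dG fg0 H; move: fg0; rewrite !ler_norml => /andP[h1 h2].
have : g 0 - f 0 <= g t - f t.
  apply: (derive_ge0_leT t0 (fun x => is_deriveB1 (dG x) (dF x))) => x /H.
  by rewrite ler_norml subr_ge0 => /andP[].
have : g 0 + f 0 <= g t + f t.
  apply: (derive_ge0_leT t0 (fun x => is_deriveD1 (dG x) (dF x))) => x /H.
  by rewrite ler_norml => /andP[+ _]; rewrite lerNl -subr_ge0 opprK.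
by move=> *; apply/andP; split; lra.
Qed.

Lemma expn_half_small (c e : R) : 0 < e -> exists n, c * 2^-1 ^+ n <= e.
Proof.
move=> e0; have := truncnS_gt (`|c| / e); move: (Num.trunc _).+1 => n Hn; exists n.
have p : 0 < 2^-1 ^+ n :> R by rewrite exprn_gt0// invr_gt0.
apply: (@le_trans _ _ (`|c| * 2^-1 ^+ n)); first by apply: ler_wpM2r; rewrite ?ler_norm// ltW.
have p2 : 0 < 2 ^+ n :> R by rewrite exprn_gt0.
rewrite exprVn ler_pdivrMr// mulrC -ler_pdivrMr//.
apply: ltW; apply: (lt_trans Hn).
by rewrite -natrX ltr_nat ltn_expl.
Qed.

(** The intervals of radius [2 * c / 2 ^ n] around [x n] are nested, and the limit is the supremum
    of their left ends; this gives the rate along with the limit. *)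
Lemma geometric_limit (x : nat -> R) (c : R) : 
  (forall n, `|x n.+1 - x n| <= c * 2^-1 ^+ n) ->
  exists y, forall n, `|y - x n| <= 2 * c * 2^-1 ^+ n.
Proof.
move=> H.
pose u n := x n - 2 * c * 2^-1 ^+ n; pose v n := x n + 2 * c * 2^-1 ^+ n.
have half n : 2^-1 ^+ n = 2 * 2^-1 ^+ n.+1 :> R by rewrite exprS mulrA divff ?mul1r.
have u1 n : u n <= u n.+1.
  by have := H n; rewrite ler_norml /u half => /andP[h _]; lra.
have v1 n : v n.+1 <= v n.
  by have := H n; rewrite ler_norml /v half => /andP[_ h]; lra.
have uv n : u n <= v n.
  by rewrite /u /v; have := le_trans (normr_ge0 _) (H n); lra.
have uD n k : u n <= u (n + k)%N.
  by elim: k => [|k IH]; rewrite ?addn0// addnS (le_trans IH).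
have vD n k : v (n + k)%N <= v n.
  by elim: k => [|k IH]; rewrite ?addn0// addnS (le_trans _ IH).
have uvmn n m : u n <= v m.
  by apply: (le_trans (uD n m)); apply: (le_trans (uv _)); rewrite addnC vD.
pose S := [set u n | n in [set: nat]].
have S0 : S !=set0 by exists (u 0%N); exists 0%N.
exists (sup S) => n; rewrite ler_norml; apply/andP; split.
  have : u n <= sup S.
    apply: ub_le_sup; last by exists n.
    by exists (v 0%N) => _ [k _ <-].
  by rewrite /u; lra.
have : sup S <= v n by apply: ge_sup => // _ [k _ <-].
by rewrite /v; lra.
Qed.

Lemma lipschitz_continuous (f : R -> R) (M : R) :
  (forall x y, `|f x - f y| <= M * `|x - y|) -> continuous f.
Proof.
move=> H x; apply/cvgrPdist_le => e e0.
have M0 : 0 <= M.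
  by have := le_trans (normr_ge0 _) (H 1 0); rewrite subr0 normr1 mulr1.
near=> y; apply: (le_trans (H x y)).
apply: (@le_trans _ _ ((M + 1) * `|x - y|)); first by rewrite ler_wpM2r// lerDl.
rewrite mulrC -ler_pdivlMr; last by rewrite ltr_wpDl.
near: y; apply/nbhs_ballP; exists (e / (M + 1)) => /=; first by rewrite divr_gt0// ltr_wpDl.
by move=> y /= /ltW.
Unshelve. all: by end_near. Qed.

Lemma maxr0_lipschitz (x y : R) : `|Num.max x 0 - Num.max y 0| <= `|x - y|.
Proof.
have := ler_norm (x - y); have := ler_norm (y - x); rewrite (distrC y x) => h1 h2.
have := normr_ge0 (x - y) => h3; rewrite (ler_norml (_ - _)).
have [x0|x0] := leP 0 x; have [y0|y0] := leP 0 y; apply/andP; split; lra.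
Qed.

(* For the weight [expR (- 2 L t)] the Picard map halves distances, so the solution
   is global in positive time. *)
Lemma picard (F : R -> R -> R) (L M a : R) : 0 < L ->
  (forall q, continuous q -> continuous (fun t => F t (q t))) ->
  (forall t x y, `|F t x - F t y| <= L * `|x - y|) ->
  (forall t x, `|F t x| <= M) ->
  exists2 q : R -> R, q 0 = a & forall t : R, 0 <= t -> is_derive t (1 : R) q (F t (q t)).
Proof.
move=> L0 cF LF MF.
have M0 : 0 <= M := le_trans (normr_ge0 _) (MF 0 0).
have [prim Hprim] : exists prim : (R -> R) -> (R -> R), forall h, continuous h ->
    prim h 0 = 0 /\ forall x, is_derive x (1 : R) (prim h) (h x).
  have /choice [prim H] : forall h : R -> R, exists H : R -> R, continuous h ->
      H 0 = 0 /\ forall x, is_derive x (1 : R) H (h x).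
    move=> h; have [ch|nch] := pselect (continuous h); last by exists h.
    by have [H H0 dH] := exists_primitive ch; exists H.
  by exists prim.
(* The weighted estimates hold for nonnegative times only, so [q] is frozen before 0; primitives on
   the whole line still give a two-sided derivative at 0. *)
pose rhs (q : R -> R) s := F s (q (Num.max s 0)).
have c0 : continuous (fun s : R => Num.max s 0).
  by apply: (@lipschitz_continuous _ 1) => x y; rewrite mul1r maxr0_lipschitz.
have crhs q : continuous q -> continuous (rhs q).
  by move=> cq; apply: cF; exact: (cont_comp cq c0).
pose T (q : R -> R) := fun t => a + prim (rhs q) t.
have T0 q : continuous q -> T q 0 = a by move=> /crhs/Hprim[h _]; rewrite /T h addr0.
have dT q (t : R) : continuous q -> is_derive t (1 : R) (T q) (rhs q t).
  move=> /crhs/Hprim[_ h]; rewrite -[rhs q t]add0r.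
  exact: (is_deriveD1 (is_deriveC1 a t) (h t)).
have cT q : continuous q -> continuous (T q).
  by move=> cq t; exact: is_derive_cont (dT q t cq).
pose qn n := iter n T (fun _ => a).
have cqn n : continuous (qn n) by elim: n => [|n IH]; [exact: cont_cst|exact: cT].
(* As [2 * L * A = M], the derivative of [A * expR (2 * L * t)] dominates that of the first
   increment. At later steps the rate [2 * L] of the weight against the Lipschitz constant [L] gains
   the factor 1/2. *)
pose A := M / (2 * L).
have A0 : 0 <= A by rewrite divr_ge0// mulr_ge0// ltW.
have dE (c t : R) : is_derive t (1 : R) (fun t => c * expR (2 * L * t)) (2 * L * c * expR (2 * L * t)).
  by eapply is_derive_val_eq; [deriv|rewrite /=; ring].
have step n t : 0 <= t -> `|qn n.+1 t - qn n t| <= A * expR (2 * L * t) * 2^-1 ^+ n.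
  elim: n t => [|n IH] t t0.
    rewrite expr0 mulr1.
    apply: (derive_norm_le t0 (fun x => is_deriveB1 (dT _ x (cqn 0%N)) (is_deriveC1 a x)) (dE A)).
      by rewrite T0// subrr normr0 mulr0 expR0 mulr1.
    move=> x /andP[x0 _]; rewrite subr0 (le_trans (MF _ _))//.
    have -> : 2 * L * A = M by rewrite /A mulrC divfK// gt_eqF// mulr_gt0.
    rewrite ler_peMr// -expR0 ler_expR !mulr_ge0// ltW//.
  rewrite mulrAC.
  apply: (derive_norm_le t0 (fun x => is_deriveB1 (dT _ x (cqn n.+1)) (dT _ x (cqn n))) (dE _)).
    by rewrite !T0// subrr normr0 mulr0 expR0 mulr1 mulr_ge0// exprn_ge0.
  move=> x /andP[x0 _]; rewrite /rhs max_l ?(ltW x0)//.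
  apply: (le_trans (LF _ _ _)).
  have -> : 2 * L * (A * 2^-1 ^+ n.+1) * expR (2 * L * x) = L * (A * expR (2 * L * x) * 2^-1 ^+ n).
    by rewrite exprS; field.
  by rewrite ler_pM2l// IH// ltW.
have /choice [q Hq] : forall t, exists y, 0 <= t -> forall n,
    `|y - qn n t| <= 2 * (A * expR (2 * L * t)) * 2^-1 ^+ n.
  move=> t; have [t0|_] := leP 0 t; last by exists 0.
  have [y Hy] := @geometric_limit (fun n => qn n t) _ (fun n => step n t t0).
  by exists y.
(* The Lipschitz constant common to all iterates passes to the limit, which makes [q] continuous on
   nonnegative times. *)
have lipn n s t : `|qn n s - qn n t| <= M * `|s - t|.
  wlog st : s t / s <= t.
    by move=> H; have [/H//|/ltW/H] := leP s t; rewrite (distrC (qn n t)) (distrC t).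
  case: n => [|n]; first by rewrite subrr normr0 mulr_ge0.
  rewrite distrC (distrC s) (ger0_norm (_ : 0 <= t - s)) ?subr_ge0//.
  have [c _ ->] := @MVT_segment _ (qn n.+1) (rhs (qn n)) s t st (fun x _ => dT _ x (cqn n))
    (continuous_subspaceT (cqn n.+1)).
  rewrite normrM (ger0_norm (_ : 0 <= t - s)) ?subr_ge0// ler_wpM2r ?subr_ge0//; exact: MF.
have lipq s t : 0 <= s -> 0 <= t -> `|q s - q t| <= M * `|s - t|.
  move=> s0 t0; apply/ler_addgt0Pr => e e0.
  have [n Hn] := @expn_half_small (2 * (A * expR (2 * L * s)) + 2 * (A * expR (2 * L * t))) e e0.
  have h1 := Hq s s0 n; have h2 := Hq t t0 n; have h3 := lipn n s t.
  rewrite distrC in h2.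
  have -> : q s - q t = (q s - qn n s) + (qn n s - qn n t) + (qn n t - q t) by ring.
  apply: (le_trans (ler_normD _ _)); rewrite mulrDl in Hn.
  apply: (@le_trans _ _ (2 * (A * expR (2 * L * s)) * 2^-1 ^+ n + M * `|s - t|
    + 2 * (A * expR (2 * L * t)) * 2^-1 ^+ n)).
    by apply: lerD h2; apply: (le_trans (ler_normD _ _)); exact: lerD.
  lra.
pose qc t := q (Num.max t 0).
have cqc : continuous qc.
  apply: (@lipschitz_continuous _ M) => x y.
  rewrite (le_trans (lipq _ _ _ _)) ?le_max ?lexx ?orbT//.
  by rewrite ler_wpM2l// maxr0_lipschitz.
have cT' : continuous (fun s => F s (qc s)) by exact: cF.
(* One more Picard step, applied to the limit: [Q] is differentiable by construction, and it is
   approached by the same iterates as [q], hence equal to it for [0 <= t]. *)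
pose Q t := a + prim (fun s => F s (qc s)) t.
have dQ (t : R) : is_derive t (1 : R) Q (F t (qc t)).
  have [_ h] := Hprim _ cT'; rewrite -[F t _]add0r.
  exact: (is_deriveD1 (is_deriveC1 a t) (h t)).
have Q0 : Q 0 = a by rewrite /Q (Hprim _ cT').1 addr0.
have Qq t : 0 <= t -> Q t = q t.
  move=> t0; apply/eqP; rewrite -subr_eq0 -normr_le0; apply/ler_addgt0Pr => e e0; rewrite add0r.
  have [n Hn] := @expn_half_small (2 * (A * expR (2 * L * t))) e e0.
  have h1 := Hq t t0 n.+1.
  have h2 : `|Q t - qn n.+1 t| <= A * 2^-1 ^+ n * expR (2 * L * t).
    apply: (derive_norm_le t0 (fun x => is_deriveB1 (dQ x) (dT _ x (cqn n))) (dE _)).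
      by rewrite Q0 T0// subrr normr0 mulr0 expR0 mulr1 mulr_ge0// exprn_ge0.
    move=> x /andP[x0 _]; rewrite /rhs /qc max_l ?(ltW x0)//.
    apply: (le_trans (LF _ _ _)).
    have -> : 2 * L * (A * 2^-1 ^+ n) * expR (2 * L * x) = L * (2 * (A * expR (2 * L * x)) * 2^-1 ^+ n).
      by ring.
    by rewrite ler_pM2l// Hq// ltW.
  rewrite distrC in h1.
  have -> : Q t - q t = (Q t - qn n.+1 t) + (qn n.+1 t - q t) by ring.
  apply: (le_trans (ler_normD _ _)); apply: le_trans Hn.
  apply: (le_trans (lerD h2 h1)); rewrite exprS le_eqVlt; apply/orP; left; apply/eqP.
  by field.
exists Q => // t t0; rewrite (Qq _ t0).
by have := dQ t; rewrite /qc max_l.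
Qed.

End flow.

(** * Riccati inequalities *)

Section riccati.
Context {R : realType}.

Lemma is_derive_V1 (f : R -> R) (x df : R) : f x != 0 -> is_derive x (1 : R) f df ->
  is_derive x (1 : R) (fun t => (f t)^-1) (- (f x) ^- 2 * df).
Proof. by move=> fx H; exact: (@is_deriveV _ f x df 1 fx H). Qed.

Lemma continuous_at_within (f : R -> R) (a b : R) :
  (forall t, a <= t <= b -> {for t, continuous f}) -> {within `[a, b], continuous f}.
Proof.
move=> H; apply/continuous_in_subspaceT => t; rewrite inE/= in_itv/=; exact: H.
Qed.

(** While [A] and [B] exceed [d], the bound on [e] gives [A B - e >= A B / 2]. Hence both increase,
    which keeps them above [d], and [1/A + 1/B + t] does not increase because [A/B + B/A >= 2]. It
    starts below [2 / d], but at time [T] it exceeds [T >= 2 / d]. *)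
Lemma riccati_pair (A B dA dB : R -> R) (T d e : R) : 0 < d -> 0 <= e -> e <= d ^+ 2 / 2 ->
  2 / d <= T ->
  (forall t, 0 <= t <= T -> {for t, continuous A} /\ {for t, continuous B}) ->
  (forall t, 0 < t < T -> is_derive t (1 : R) A (dA t) /\ is_derive t (1 : R) B (dB t)) ->
  (forall t, 0 < t < T -> A t * B t - e <= dA t /\ A t * B t - e <= dB t) ->
  d < A 0 -> d < B 0 -> False.
Proof.
move=> d0 e0 ed dT cAB dAB HAB A0 B0.
have T0 : 0 < T by apply: lt_le_trans dT; rewrite divr_gt0.
pose good t := forall s, 0 <= s <= t -> d < A s /\ d < B s.
pose G := [set t | 0 <= t <= T /\ good t].
have G0 : G 0.
  split; first by rewrite lexx ltW.
  by move=> s; rewrite -eq_le => /eqP <-.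
have supG : has_sup G by split; [exists 0|exists T => t [/andP[]]].
pose tau := sup G.
have tau0 : 0 <= tau by apply: ub_le_sup => //; exact: (proj2 supG).
have tauT : tau <= T by apply: ge_sup; [exists 0|move=> t [/andP[]]].
have below s : 0 <= s < tau -> d < A s /\ d < B s.
  move=> /andP[s0 st]; have [|t [_ gt] ss] := @sup_adherent _ G (tau - s) _ supG.
    by rewrite subr_gt0.
  by apply: gt; rewrite s0 ltW//; move: ss; rewrite -/tau; lra.
have cw (f : R -> R) x : 0 <= x -> x <= T -> (forall t, 0 <= t <= T -> {for t, continuous f}) ->
   {within `[0, x], continuous f}.
  move=> x0 xT H; apply: continuous_at_within => t /andP[t0 tx]; apply: H.
  by rewrite t0 (le_trans tx).
(* Monotonicity up to the supremum [tau] transports the strict initial inequalities to [tau]; by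
   continuity they would persist beyond it if [tau < T]. *)
have mono : A 0 <= A tau /\ B 0 <= B tau.
  split.
    apply: (@derive_ge0_le _ A dA) => //; first by apply: cw => // t /cAB[].
      by move=> x /andP[x0 xt]; apply: (proj1 (dAB x _)); rewrite x0 (lt_le_trans xt).
    move=> x /andP[x0 xt]; have [h1 h2] := below x (ltac:(by rewrite ltW)).
    apply: le_trans (proj1 (HAB x _)); last by rewrite x0 (lt_le_trans xt).
    nra.
  apply: (@derive_ge0_le _ B dB) => //; first by apply: cw => // t /cAB[].
    by move=> x /andP[x0 xt]; apply: (proj2 (dAB x _)); rewrite x0 (lt_le_trans xt).
  move=> x /andP[x0 xt]; have [h1 h2] := below x (ltac:(by rewrite ltW)).
  apply: le_trans (proj2 (HAB x _)); last by rewrite x0 (lt_le_trans xt).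
  nra.
have At : d < A tau by apply: lt_le_trans (proj1 mono).
have Bt : d < B tau by apply: lt_le_trans (proj2 mono).
have tauE : tau = T.
  apply/eqP; rewrite eq_le tauT leNgt; apply/negP => tT.
  have [cA cB] := cAB tau (ltac:(by rewrite tau0 tauT)).
  have [r1 r10 H1] := continuousP_at cA (ltac:(by rewrite subr_gt0) : 0 < A tau - d).
  have [r2 r20 H2] := continuousP_at cB (ltac:(by rewrite subr_gt0) : 0 < B tau - d).
  pose r := Num.min (T - tau) (Num.min (r1 / 2) (r2 / 2)).
  have r0 : 0 < r by rewrite !lt_min; apply/and3P; split; lra.
  have rT : r <= T - tau by rewrite /r ge_min lexx.
  have rr1 : r < r1 by rewrite /r !gt_min; apply/orP; right; apply/orP; left; lra.
  have rr2 : r < r2 by rewrite /r !gt_min; apply/orP; right; apply/orP; right; lra.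
  have : tau + r <= tau; last by lra.
  apply: ub_le_sup; first exact: (proj2 supG).
  split; first by apply/andP; split; lra.
  move=> s /andP[s0 sr]; have [st|ts] := ltP s tau; first by apply: below; rewrite s0.
  have sd : `|s - tau| <= r by rewrite ger0_norm; lra.
  have := H1 s (le_lt_trans sd rr1); have := H2 s (le_lt_trans sd rr2).
  by rewrite !ltr_norml => /andP[h1 _] /andP[h2 _]; split; lra.
have all t : 0 <= t <= T -> d < A t /\ d < B t.
  move=> /andP[t0]; rewrite le_eqVlt => /orP[/eqP->|tT]; first by rewrite -tauE.
  by apply: below; rewrite t0 tauE.
pose S t := - ((A t)^-1 + (B t)^-1 + t).
pose dS t := - (- (A t) ^- 2 * dA t + - (B t) ^- 2 * dB t + 1).
have nz t : 0 <= t <= T -> A t != 0 /\ B t != 0.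
  by move=> /all[h1 h2]; rewrite !gt_eqF// (lt_trans d0).
have : S 0 <= S T.
  apply: (@derive_ge0_le _ S dS); rewrite ?(ltW T0)//.
  - apply: continuous_at_within => t tT; have [cA cB] := cAB t tT; have [nA nB] := nz t tT.
    apply: cvgN; apply: cvgD; last exact: cvg_id.
    by apply: cvgD; apply: cvgV.
  - move=> t /andP[t0 tT]; have [|hA hB] := dAB t; first by rewrite t0.
    have [nA nB] := nz t (ltac:(by rewrite !ltW)).
    by apply: is_derive_N1; apply: is_deriveD1 (is_deriveI1 _); apply: is_deriveD1; exact: is_derive_V1.
  move=> t tT; have [h1 h2] := HAB t tT; move/andP: tT => [t0 tT].
  have [h3 h4] := all t (ltac:(by rewrite !ltW)).
  rewrite /dS !mulNr; move: h1 h2 h3 h4; move: (A t) (B t) (dA t) (dB t) => x y dx dy *.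
  have x0 : 0 < x by apply: lt_trans d0 _.
  have y0 : 0 < y by apply: lt_trans d0 _.
  have ex : x * y / 2 <= dx by nra.
  have ey : x * y / 2 <= dy by nra.
  have : x ^- 2 * (x * y / 2) <= x ^- 2 * dx by rewrite ler_pM2l// invr_gt0 exprn_gt0.
  have : y ^- 2 * (x * y / 2) <= y ^- 2 * dy by rewrite ler_pM2l// invr_gt0 exprn_gt0.
  have -> : x ^- 2 * (x * y / 2) = y / x / 2 by field; rewrite gt_eqF.
  have -> : y ^- 2 * (x * y / 2) = x / y / 2 by field; rewrite gt_eqF.
  have : 0 <= (x - y) ^+ 2 / (x * y) by rewrite divr_ge0 ?sqr_ge0// mulr_ge0 ?ltW.
  have -> : (x - y) ^+ 2 / (x * y) = x / y + y / x - 2 by field; rewrite !gt_eqF.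
  by lra.
have [AT BT] := all T (ltac:(by rewrite lexx ltW)).
have pA : 0 < (A T)^-1 by rewrite invr_gt0 (lt_trans d0).
have pB : 0 < (B T)^-1 by rewrite invr_gt0 (lt_trans d0).
have qA : (A 0)^-1 < d^-1 by rewrite ltf_pV2 ?posrE// (lt_trans d0).
have qB : (B 0)^-1 < d^-1 by rewrite ltf_pV2 ?posrE// (lt_trans d0).
move: dT; rewrite /S; lra.
Qed.

End riccati.

(** * Difference quotients along characteristics *)

Section characteristics.
Context {R : realType}.

Let beta : R := Num.sqrt (3 / 2).

Lemma beta_sqr : beta ^+ 2 = 3 / 2. Proof. by rewrite sqr_sqrtr; lra. Qed.
Lemma beta_ge0 : 0 <= beta. Proof. exact: sqrtr_ge0. Qed.
(** Equivalent to [4 * (beta - 1) <= beta + 1], which makes [(1 - beta) * x + (1 + beta) * y]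
    nonnegative when [0 <= x <= 4 * y]. *)
Lemma beta_le : 3 * beta <= 5.
Proof. by have := beta_sqr; have := beta_ge0; nra. Qed.

Lemma derive_lipschitz (f df : R -> R) (K x y : R) :
  (forall z, is_derive z (1 : R) f (df z)) -> (forall z, `|df z| <= K) ->
  `|f y - f x| <= K * `|y - x|.
Proof.
move=> dF HK; wlog xy : x y / x <= y.
  by move=> H; have [/H//|/ltW/H] := leP x y; rewrite distrC (distrC x).
have cf : continuous f by move=> z; exact: is_derive_cont (dF z).
have [c _ ->] := MVT_segment xy (fun z _ => dF z) (continuous_subspaceT cf).
by rewrite normrM ler_wpM2r.
Qed.

(** [G = - (p * g)'] has derivative [g - p * g]. The mean value theorem evaluates it at an
    intermediate point, and [K], a Lipschitz constant of that derivative, moves the point to [x]. *)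
Lemma kernel_halves_MVT (g dg X Y : R -> R) (K x y : R) :
  kernel_halves g X Y -> (forall z, is_derive z (1 : R) g (dg z)) ->
  (forall z, `|dg z - (X z - Y z)| <= K) -> x != y ->
  (- (X y - Y y) + (X x - Y x)) / (y - x) <= g x - X x - Y x + K * `|y - x|.
Proof.
move=> [_ _ dX dY] dg_ HK xy.
pose G z := - (X z - Y z).
have dG z : is_derive z (1 : R) G (g z - X z - Y z).
  have dXz := dX z; have dYz := dY z.
  by eapply is_derive_val_eq; [rewrite /G; deriv|rewrite /=; field].
have cG : continuous G by move=> z; exact: is_derive_cont (dG z).
have ddG z : is_derive z (1 : R) (fun z => g z - X z - Y z) (dg z - (X z - Y z)).
  have dXz := dX z; have dYz := dY z; have dgz := dg_ z.
  by eapply is_derive_val_eq; [deriv|rewrite /=; field].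
have mvt u v : u < v -> exists2 c, `|c - u| <= `|v - u| /\ `|c - v| <= `|v - u| &
    (G v - G u) / (v - u) = g c - X c - Y c.
  move=> uv.
  have [c Hc ->] := MVT uv (fun z _ => dG z) (continuous_subspaceT cG).
  exists c; last by rewrite mulfK// subr_eq0 gt_eqF.
  move: Hc; rewrite in_itv/= => /andP[uc cv].
  have -> : `|v - u| = v - u by rewrite gtr0_norm// subr_gt0.
  have -> : `|c - u| = c - u by rewrite gtr0_norm// subr_gt0.
  have -> : `|c - v| = v - c by rewrite distrC gtr0_norm// subr_gt0.
  by split; lra.
have [c cx E] : exists2 c, `|c - x| <= `|y - x| & (G y - G x) / (y - x) = g c - X c - Y c.
  have [xy'|yx|xy'] := ltgtP x y; last by rewrite xy' eqxx in xy.
    by have [c [c1 c2] E] := mvt _ _ xy'; exists c.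
  have [c [c1 c2] E] := mvt _ _ yx; exists c; first by rewrite (distrC y).
  by rewrite -E -(opprB (G x)) -(opprB x) invrN mulrNN.
have -> : - (X y - Y y) + (X x - Y x) = G y - G x by rewrite /G; ring.
rewrite E.
have := derive_lipschitz x c ddG HK.
have K0 : 0 <= K := le_trans (normr_ge0 _) (HK 0).
rewrite ler_norml => /andP[_ h].
have := ler_wpM2l K0 cx; lra.
Qed.

(* Two nearby characteristics make the slope difference quotient differentiable in time,
   although [v_x] itself need not be. *)
Lemma characteristic_blowup (v vx X Y : R -> R -> R) (kappa T M L d a h : R)
    (q1 q2 : R -> R) :
  (forall t x, 0 <= t <= T -> is_derive x (1 : R) (v t) (vx t x)) ->
  (forall t x, 0 <= t <= T -> `|v t x + kappa| <= M /\ `|vx t x| <= L) ->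
  (forall t, 0 < t < T -> kernel_halves (fun x => 3 / 2 * (v t x + kappa) ^+ 2) (X t) (Y t)) ->
  q1 0 = a -> q2 0 = a + h ->
  (forall t : R, 0 <= t <= T -> is_derive t (1 : R) q1 (v t (q1 t)) /\
     is_derive t (1 : R) q2 (v t (q2 t))) ->
  (forall t, 0 <= t <= T -> {for t, continuous (fun t => v t (q1 t))} /\
     {for t, continuous (fun t => v t (q2 t))}) ->
  (forall t : R, 0 < t < T ->
     is_derive t (1 : R) (fun t => v t (q1 t)) (- (X t (q1 t) - Y t (q1 t))) /\
     is_derive t (1 : R) (fun t => v t (q2 t)) (- (X t (q2 t) - Y t (q2 t)))) ->
  0 < h -> 0 < d -> 2 / d <= T ->
  (3 * M * L + M ^+ 2) * (h * expR (L * T)) <= d ^+ 2 / 2 ->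
  d < - ((v 0 (a + h) - v 0 a) / h) + beta * (v 0 a + kappa) ->
  d < - ((v 0 (a + h) - v 0 a) / h) - beta * (v 0 a + kappa) -> False.
Proof.
move=> dv bd HXY q10 q20 dq cu du h0 d0 dT small A0 B0.
have T0 : 0 < T by apply: lt_le_trans dT; rewrite divr_gt0.
have T00 : (0 : R) <= 0 <= T by rewrite lexx ltW.
have M0 : 0 <= M by apply: le_trans (normr_ge0 _) (proj1 (bd 0 0 T00)).
have L0 : 0 <= L by apply: le_trans (normr_ge0 _) (proj2 (bd 0 0 T00)).
pose D t := q2 t - q1 t; pose W t := v t (q2 t) - v t (q1 t).
have dD (t : R) : 0 <= t <= T -> is_derive t (1 : R) D (W t).
  by move=> /dq[h1 h2]; exact: is_deriveB1.
have cD t : 0 <= t <= T -> {for t, continuous D}.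
  by move=> tT; exact: is_derive_cont (dD t tT).
have WD t : 0 <= t <= T -> `|W t| <= L * `|D t|.
  by move=> tT; apply: (derive_lipschitz _ _ (fun z => dv t z tT)) => z; exact: (proj2 (bd t z tT)).
have WD2 t : 0 <= t <= T -> `|D t * W t| <= L * D t ^+ 2.
  move=> tT; rewrite normrM -(ger0_norm (sqr_ge0 (D t))) normrX expr2 mulrA mulrC.
  by rewrite ler_wpM2r// WD.
have D0 : D 0 = h by rewrite /D q10 q20; ring.
have sub t : 0 <= t <= T -> forall x, 0 < x < t -> 0 <= x <= T.
  by move=> /andP[t0 tT] x /andP[x0 xt]; rewrite ltW//= ltW// (lt_le_trans xt).
(* Two Gronwall estimates for [D ^+ 2], both from [|W| <= L * |D|]: the lower one keeps the
   characteristics apart, so that division by [D] is legitimate, and the upper one controls the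
   error. Squares avoid a discussion of signs. *)
have Dbd t : 0 <= t <= T -> D t != 0 /\ `|D t| <= h * expR (L * T).
  move=> tT; move/andP: (tT) => [t0 tT'].
  have dE c (x : R) : 0 <= x <= T -> is_derive x (1 : R) (fun x => D x ^+ 2 * expR (c * x))
      ((2 * (D x * W x) + c * D x ^+ 2) * expR (c * x)).
    move=> /dD dDx; under eq_fun do rewrite expr2.
    by eapply is_derive_val_eq; [deriv|rewrite /=; ring].
  have cE c : {within `[0, t], continuous (fun x => D x ^+ 2 * expR (c * x))}.
    apply: continuous_at_within => x /andP[x0 xt]; apply: is_derive_cont (dE c x _).
    by rewrite x0 (le_trans xt).
  have low : h ^+ 2 <= D t ^+ 2 * expR (2 * L * t).
    have := @derive_ge0_le _ (fun x => D x ^+ 2 * expR (2 * L * x)) _ 0 t t0 (cE _)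
      (fun x xt => dE _ x (sub t tT x xt)).
    rewrite D0 mulr0 expR0 mulr1; apply => x xt; rewrite mulr_ge0 ?expR_ge0//.
    by have := WD2 x (sub t tT x xt); rewrite ler_norml => /andP[]; lra.
  have up : D t ^+ 2 * expR (- (2 * L) * t) <= h ^+ 2.
    rewrite -lerN2.
    have := @derive_ge0_le _ (fun x => - (D x ^+ 2 * expR (- (2 * L) * x))) _ 0 t t0 _
      (fun x xt => is_derive_N1 (dE _ x (sub t tT x xt))).
    rewrite D0 mulr0 expR0 mulr1; apply.
      by move=> x; apply: cvgN; exact: cE.
    move=> x xt; rewrite -mulNr mulr_ge0 ?expR_ge0//.
    by have := WD2 x (sub t tT x xt); rewrite ler_norml => /andP[]; lra.
  split.
    apply/eqP => Dt0; move: low; rewrite Dt0 expr0n mul0r.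
    by have := exprn_gt0 2 h0; lra.
  rewrite -ler_sqr ?nnegrE ?mulr_ge0 ?expR_ge0 ?(ltW h0)// real_normK ?num_real//.
  apply: (@le_trans _ _ (h ^+ 2 * expR (2 * L * t))).
    have -> : D t ^+ 2 = D t ^+ 2 * expR (- (2 * L) * t) * expR (2 * L * t).
      by rewrite -mulrA -expRD mulNr addNr expR0 mulr1.
    by rewrite ler_wpM2r ?expR_ge0.
  rewrite exprMn ler_wpM2l ?sqr_ge0// -expRM_natl ler_expR.
  by have := ler_wpM2l L0 tT'; lra.
(* [phi] stands for [v_x]. Since [D] has derivative [W], the quotient rule produces the Riccati term
   [- phi ^+ 2] exactly; only the nonlocal term is approximated. *)
pose phi t := W t / D t.
pose U t := v t (q1 t) + kappa.
pose G2 t := - (X t (q2 t) - Y t (q2 t)); pose G1 t := - (X t (q1 t) - Y t (q1 t)).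
pose dphi t := (G2 t - G1 t) / D t - phi t ^+ 2.
have dPhi (t : R) : 0 < t < T -> is_derive t (1 : R) phi (dphi t).
  move=> tT; have tT' : 0 <= t <= T by move/andP: tT => [? ?]; rewrite !ltW.
  have [Dn _] := Dbd t tT'.
  have dW : is_derive t (1 : R) W (G2 t - G1 t) by have [? ?] := du t tT; exact: is_deriveB1.
  apply: is_derive_val_eq; first exact: (is_deriveM1 dW (is_derive_V1 Dn (dD t tT'))).
  by rewrite /dphi /phi; field.
have cphi t : 0 <= t <= T -> {for t, continuous phi}.
  move=> tT; have [h1 h2] := cu t tT; apply: cvgM; first by apply: cvgB.
  by apply: cvgV; [exact: (proj1 (Dbd t tT))|exact: cD].
have cU t : 0 <= t <= T -> {for t, continuous U}.
  by move=> tT; have [h1 h2] := cu t tT; apply: cvgD => //; exact: cvg_cst.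
have dU (t : R) : 0 < t < T -> is_derive t (1 : R) U (G1 t).
  by move=> tT; have [h1 h2] := du t tT; rewrite -[G1 t]addr0; exact: (is_deriveD1 h1 (is_deriveC1 _ _)).
pose eps := (3 * M * L + M ^+ 2) * (h * expR (L * T)).
have eps0 : 0 <= eps by rewrite /eps !mulr_ge0 ?addr_ge0 ?expR_ge0 ?mulr_ge0 ?sqr_ge0// ltW.
pose A t := - phi t + beta * U t; pose B t := - phi t - beta * U t.
apply: (@riccati_pair _ A B (fun t => - dphi t + beta * G1 t)
  (fun t => - dphi t - beta * G1 t) T d eps) => //.
- move=> t tT; split.
    by apply: cvgD; [apply: cvgN; exact: cphi|apply: cvgM; [exact: cvg_cst|exact: cU]].
  by apply: cvgB; [apply: cvgN; exact: cphi|apply: cvgM; [exact: cvg_cst|exact: cU]].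
- move=> t tT; have dp := dPhi t tT; have dUt := dU t tT.
  by split; rewrite /A /B; (eapply is_derive_val_eq; [deriv|rewrite /=; ring]).
- move=> t tT; have tT' : 0 <= t <= T by move/andP: tT => [? ?]; rewrite !ltW.
  have [Dn Db] := Dbd t tT'.
  have XY := HXY t tT.
  have g0 x : 0 <= 3 / 2 * (v t x + kappa) ^+ 2 by rewrite mulr_ge0 ?sqr_ge0//; lra.
  have gM x : 3 / 2 * (v t x + kappa) ^+ 2 <= 3 / 2 * M ^+ 2.
    rewrite ler_pM2l; last by lra.
    by rewrite -(real_normK (num_real (v t x + kappa))) ler_sqr ?nnegrE// (proj1 (bd t x tT')).
  (* Both halves lie between 0 and [3 / 4 * M ^+ 2]. Together with the bound [3 * M * L] on the
     slope of [3 / 2 * (v + kappa) ^+ 2], this is the origin of the constant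
     [3 * M * L + M ^+ 2]. *)
  have XYM x : `|X t x - Y t x| <= M ^+ 2.
    have [x0 y0 _ _] := kernel_halves_bounds XY g0 x; have [xM yM] := kernel_halves_le XY gM x.
    have := sqr_ge0 M; rewrite ler_norml => ?; apply/andP; split; lra.
  have dg (z : R) : is_derive z (1 : R) (fun x => 3 / 2 * (v t x + kappa) ^+ 2)
     (3 * (v t z + kappa) * vx t z).
    under eq_fun do rewrite expr2; have dvz := dv t z tT'.
    by eapply is_derive_val_eq; [deriv|rewrite /=; field].
  have KK z : `|3 * (v t z + kappa) * vx t z - (X t z - Y t z)| <= 3 * M * L + M ^+ 2.
    apply: (le_trans (ler_normB _ _)); apply: lerD => //.
    have [h1 h2] := bd t z tT'; rewrite !normrM normr_nat ler_pM//.
    by rewrite ler_pM2l.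
  have Dn' : q1 t != q2 t by apply: contra_neq Dn => E; rewrite /D E subrr.
  have := kernel_halves_MVT XY dg KK Dn'.
  have -> : - (X t (q2 t) - Y t (q2 t)) + (X t (q1 t) - Y t (q1 t)) = G2 t - G1 t.
    by rewrite /G1 /G2; ring.
  rewrite -/(D t) => Hm.
  have He : (3 * M * L + M ^+ 2) * `|D t| <= eps.
    by apply: ler_wpM2l => //; rewrite addr_ge0 ?sqr_ge0// !mulr_ge0.
  have [x0 y0 yx xy] := kernel_halves_bounds XY g0 (q1 t).
  have b2 := beta_sqr; have b0 := beta_ge0; have b5 := beta_le.
  have E : A t * B t = phi t ^+ 2 - 3 / 2 * U t ^+ 2.
    by rewrite /A /B -b2; ring.
  rewrite E /dphi; move: Hm; rewrite -/(U t) {E}.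
  move: (_ / D t) => P; rewrite /G1.
  move: P (X t (q1 t)) (Y t (q1 t)) x0 y0 yx xy He => P x y x0 y0 yx xy He Hm.
  (* The convolutions of [3 / 2 * u ^+ 2] with [p - beta p'] and, on the next line, [p + beta p']:
     convolving with [p] gives [x + y], with [p'] gives [x - y]. *)
  have b1 : 0 <= (1 - beta) * x + (1 + beta) * y by nra.
  have b1' : 0 <= (1 + beta) * x + (1 - beta) * y by nra.
  by split; lra.
- by rewrite /A /U /phi /W D0 q10 q20.
- by rewrite /B /U /phi /W D0 q10 q20.
Qed.

End characteristics.

(** * Functions of time and space *)

Section joint.
Context {R : realType}.

Lemma is_derive_eps (D : R -> R) (t a : R) :
  (forall e, 0 < e -> \forall r \near t, `|D r - D t - a * (r - t)| <= e * `|r - t|) ->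
  is_derive t (1 : R) D a.
Proof.
move=> H; apply/is_derive1_caratheodory.
exists (fun z => if z == t then a else (D z - D t) / (z - t)); split; last by rewrite eqxx.
  move=> z; case: eqP => [->|/eqP]; first by rewrite !subrr mulr0.
  by rewrite -subr_eq0 => /divfK->.
apply/cvgrPdist_le => e e0; apply: filterS (H e e0) => z /=; rewrite eqxx.
case: eqVneq => [->|zt]; first by move=> _; rewrite subrr normr0 ltW.
have zt0 : z - t != 0 by rewrite subr_eq0.
rewrite (_ : _ - _ - _ = - ((a - (D z - D t) / (z - t)) * (z - t))); last by field.
by rewrite normrN normrM ler_pM2r// normr_gt0.
Qed.

Lemma joint_continuous (f : R -> R -> R) :
  (forall t, continuous (f t)) ->
  (forall t e, 0 < e -> \forall r \near t, forall x, `|f r x - f t x| <= e) ->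
  continuous (fun p : R * R => f p.1 p.2).
Proof.
move=> cf uf [t x]; apply/cvgrPdist_le => e e0 /=.
have e20 : 0 < e / 2 by lra.
have h1 := uf t _ e20.
have h2 : \forall y \near x, `|f t x - f t y| <= e / 2.
  by have /cvgrPdist_le/(_ _ e20) := cf t x.
exists ([set r | forall x, `|f r x - f t x| <= e / 2], [set y | `|f t x - f t y| <= e / 2]) => //.
move=> [r y] /= [Hr Hy].
have -> : f t x - f r y = (f t x - f t y) - (f r y - f t y) by ring.
by rewrite (le_trans (ler_normB _ _))// (splitr e) lerD.
Qed.

Lemma cont_along (f : R -> R -> R) (p q : R -> R) (t : R) :
  continuous (fun p : R * R => f p.1 p.2) -> {for t, continuous p} -> {for t, continuous q} ->
  {for t, continuous (fun t => f (p t) (q t))}.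
Proof.
move=> cf cp cq; apply: (@continuous_comp _ _ _ (fun t => (p t, q t)) (fun p : R * R => f p.1 p.2)).
  exact: (cvg_pair cp cq).
exact: cf.
Qed.

Lemma rectangle_bound (f : R -> R -> R) (T : R) : 0 <= T ->
  (forall t, periodic1 (f t)) -> continuous (fun p : R * R => f p.1 p.2) ->
  exists2 M, 0 <= M & forall t x, 0 <= t <= T -> `|f t x| <= M.
Proof.
move=> T0 pf cf.
have [|||[t0 x0] _ H] := @compact_EVT_max _ R (fun p : R * R => `|f p.1 p.2|) (`[0, T] `*` `[0, 1]).
- by exists (0, 0); split; rewrite /= in_itv/= lexx ?T0 ?ler01.
- by apply: compact_setX; exact: segment_compact.
- by apply: continuous_subspaceT => p; apply: cvg_norm; exact: cf.
exists `|f t0 x0| => // t x tT.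
rewrite -(subrK (Num.floor x)%:~R x) periodic1_int//.
apply: (H (t, x - (Num.floor x)%:~R)); rewrite inE; split; rewrite /= in_itv//=.
by have := floor_itv x; rewrite intrD => /andP[? ?]; apply/andP; split; lra.
Qed.

Lemma C1_is_derive (f : R -> R) : C1_fun f -> forall x : R, is_derive x (1 : R) f (derive1 f x).
Proof. by move=> [df _] x; split; [exact: df|rewrite derive1E]. Qed.

Lemma periodic1_derive (f g : R -> R) : (forall x : R, is_derive x (1 : R) f (g x)) ->
  periodic1 f -> periodic1 g.
Proof.
move=> df pf x.
have h : is_derive x (1 : R) (fun x => f (x + 1)) (g (x + 1) * (1 + 0)).
  exact: (@is_derive_comp1 _ f (fun y => y + 1) _ _ _ (df _) (is_deriveD1 (is_deriveI1 x) (is_deriveC1 1 x))).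
have fE : (fun x => f (x + 1)) = f by apply/funext => y; exact: pf.
rewrite fE addr0 mulr1 in h.
by rewrite -(is_derive_derive1 h) (is_derive_derive1 (df x)).
Qed.

End joint.

(** * Solutions of the Degasperis-Procesi equation *)

Section solution.
Context {R : realType}.
Context (s kappa : R) (v : R -> R -> R) (hs : 3 / 2 < s)
  (reg : forall t : R, 0 <= t -> sobolev_C1 s (v t)).

Lemma sol_periodic t : 0 <= t -> periodic1 (v t).
Proof. by move=> /reg[[[]]]. Qed.

Lemma sol_derive (t x : R) : 0 <= t -> is_derive x (1 : R) (v t) (derive1 (v t) x).
Proof. by move=> /reg[_ /C1_is_derive]; apply. Qed.

Lemma sol_continuous t : 0 <= t -> continuous (v t).
Proof. by move=> t0 x; exact: is_derive_cont (sol_derive x t0). Qed.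

Lemma sol_derive_continuous t : 0 <= t -> continuous (derive1 (v t)).
Proof. by move=> /reg[_ []]. Qed.

(** The embedding is applied to the difference in [H^s] and to its slope in [H^(s-1)]; the latter is
    what demands [s > 3/2]. Negative times are set aside because a solution is unconstrained
    there. *)
Lemma sol_sup_continuous (t e : R) : continuous_sobolev s +oo v -> 0 <= t -> 0 < e ->
  \forall r \near t, 0 <= (r : R) -> forall x : R,
    `|v r x - v t x| <= e /\ `|derive1 (v r) x - derive1 (v t) x| <= e.
Proof.
move=> cv t0 e0.
have [|C1 C10 E1] := @sobolev_embedding R s; first by (have := hs; lra).
have [|C2 C20 E2] := @sobolev_embedding R (s - 1); first by (have := hs; lra).
have p0 := pi_gt0 R.
have c20 : 0 < C2 * (2 * pi) by rewrite !mulr_gt0.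
pose e' := Num.min (e / C1) (e / (C2 * (2 * pi))).
have e'0 : 0 < e' by rewrite lt_min !divr_gt0.
have tt : time_interval +oo t by split => //; exact: ltry.
have Hn : \forall r \near t, time_interval +oo r ->
    (sobolev_norm s (fun x => v r x - v t x)%R <= e'%:E)%E.
  exact: (near_sobolev_norm_le e'0 (cv t tt)).
apply: filterS Hn => r Hr r0 x.
have rr : time_interval +oo r by split => //; exact: ltry.
have H := sobolev_norm_le (ltW e'0) (Hr rr).
have pf : periodic1 (fun x => v r x - v t x) by move=> y; rewrite !sol_periodic.
have cr := sol_continuous r0; have ct := sol_continuous t0.
have cdr := sol_derive_continuous r0; have cdt := sol_derive_continuous t0.
have cf : continuous (fun x => v r x - v t x) by cont.
have cg : continuous (fun x => derive1 (v r) x - derive1 (v t) x) by cont.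
have df (y : R) : is_derive y (1 : R) (fun x => v r x - v t x) (derive1 (v r) y - derive1 (v t) y).
  by apply: is_deriveB1; exact: sol_derive.
have H2 := sobolev_le_derive pf cg df H.
split.
  apply: (le_trans (E1 _ _ cf pf e'0 H x)).
  by rewrite mulrC -ler_pdivlMr// /e' ge_min lexx.
apply: (le_trans (E2 _ _ cg (periodic1_derive df pf) _ H2 x)); first by rewrite !mulr_gt0.
by rewrite mulrA mulrC -ler_pdivlMr// /e' ge_min lexx orbT.
Qed.

(* [vt t] is a continuous function only up to a null set, which the Fourier
   coefficients do not see. *)
Lemma sol_time_expansion (vt : R -> R -> R) (t : R) :
  sobolev (s - 1) (vt t) -> sobolev_time_derivative (s - 1) +oo v vt -> 0 < t ->
  {ae lebesgue_measure, forall x : R,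
     vt t x + v t x * derive1 (v t) x
     + derive1 (circle_conv (@DP_kernel R)
         (fun y => 3 / 2 * v t y ^+ 2 + 3 * kappa * v t y)) x = 0} ->
  exists X Y, kernel_halves (fun x => 3 / 2 * (v t x + kappa) ^+ 2) X Y /\
    forall e, 0 < e -> \forall r \near t, forall x : R,
      `|v (r : R) x - v t x - (r - t) * (- (v t x * derive1 (v t) x) - (X x - Y x))| <= e * `|r - t|.
Proof.
move=> [[pvt mvt _] _] dv t0 eq.
have t0' := ltW t0.
pose g y := 3 / 2 * v t y ^+ 2 + 3 * kappa * v t y.
have ct := sol_continuous t0'; have cdt := sol_derive_continuous t0'; have pt := sol_periodic t0'.
have cg : continuous g by rewrite /g; cont.
have pg : periodic1 g by move=> x; rewrite /g pt.
have [X [Y [XY cE]]] := kernel_halves_exist cg pg.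
have dc (x : R) : derive1 (circle_conv (@DP_kernel R) g) x = X x - Y x.
  have [_ _ dX dY] := XY.
  have -> : circle_conv (@DP_kernel R) g = (fun x => X x + Y x) by apply/funext.
  by rewrite (is_derive_derive1 (is_deriveD1 (dX x) (dY x))); ring.
pose c := 3 / 2 * kappa ^+ 2.
exists (fun x => X x + c / 2), (fun x => Y x + c / 2); split.
  have := kernel_halves_shift c XY.
  rewrite (_ : (fun x => g x + c) = (fun x => 3 / 2 * (v t x + kappa) ^+ 2))//.
  by apply/funext => x; rewrite /g /c; field.
(* The continuous representative of [vt t], read from the equation. The constant added to both
   halves cancels in [X - Y], so it may be left out. *)
pose w x := - (v t x * derive1 (v t) x) - (X x - Y x).
have [pX pY dX dY] := XY.
have cX : continuous X by move=> x; exact: is_derive_cont (dX x).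
have cY : continuous Y by move=> x; exact: is_derive_cont (dY x).
have cw : continuous w by rewrite /w; cont.
have pw : periodic1 w.
  move=> x; rewrite /w pt pX pY.
  by rewrite (periodic1_derive (fun y => sol_derive y t0') pt).
move=> e e0.
have [|C C0 E] := @sobolev_embedding R (s - 1); first by (have := hs; lra).
have eC0 : 0 < e / C by rewrite divr_gt0.
have tt : time_interval +oo t by split => //; exact: ltry.
have Hn : \forall r \near t, r != t -> time_interval +oo r ->
    (sobolev_norm (s - 1) (fun x => (r - t)^-1 * (v r x - v t x) - vt t x)%R <= (e / C)%:E)%E.
  exact: (near_sobolev_norm_le eC0 (dv t tt)).
have Hp : \forall r \near t, 0 < (r : R) by exact: lt_nbhsr.
apply: filterS2 Hn Hp => r Hr r0 x.
have -> : v r x - v t x - (r - t) * (- (v t x * derive1 (v t) x) - (X x + c / 2 - (Y x + c / 2)))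
    = v r x - v t x - (r - t) * w x by rewrite /w; ring.
have [->|rt] := eqVneq r t; first by rewrite !subrr mul0r subrr normr0 mulr0.
have rt0 : r - t != 0 by rewrite subr_eq0.
have cr := sol_continuous (ltW r0); have pr := sol_periodic (ltW r0).
have cF : continuous (fun x => (r - t)^-1 * (v r x - v t x)) by cont.
have cf : continuous (fun x => (r - t)^-1 * (v r x - v t x) - w x) by cont.
have pf : periodic1 (fun x => (r - t)^-1 * (v r x - v t x) - w x) by move=> y; rewrite pr pt pw.
have := Hr rt (conj (ltW r0) (ltry r)).
rewrite (@sobolev_norm_ae _ _ _ (fun x => (r - t)^-1 * (v r x - v t x) - w x)); first last.
- case: eq => N [mN N0 HN]; exists N; split => // y /= Hy; apply: HN => /= Ey.
  apply: Hy; congr (_ - _); rewrite /w -(dc y) /g.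
  by move: Ey; rewrite -addrA => /eqP; rewrite addr_eq0 => /eqP ->; rewrite opprD.
- exact: continuous_measurable_fun.
- by apply: measurable_funB => //; exact: continuous_measurable_fun.
move=> /(sobolev_norm_le (ltW eC0)) H.
have := E _ _ cf pf eC0 H x.
rewrite (mulrC C) divfK ?gt_eqF// => Hx.
have -> : v r x - v t x - (r - t) * w x = ((r - t)^-1 * (v r x - v t x) - w x) * (r - t) by field.
by rewrite normrM ler_wpM2r.
Qed.


(** The increment is split as [v t (q r)], handled by the chain rule in space, plus [v r - v t] at
    the moving point [q r]. For the latter the expansion is uniform in [x], so only the continuity
    of [w] is left to pass from [q r] to [q t]. *)
Lemma is_derive_along (w : R -> R) (t : R) (q : R -> R) : 0 < t ->
  continuous w ->
  (forall e, 0 < e -> \forall r \near t, forall x : R,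
      `|v (r : R) x - v t x - (r - t) * w x| <= e * `|r - t|) ->
  is_derive t (1 : R) q (v t (q t)) ->
  is_derive t (1 : R) (fun r => v (Num.max r 0) (q r)) (derive1 (v t) (q t) * v t (q t) + w (q t)).
Proof.
move=> t0 cw H dq.
have Hp : \forall r \near t, 0 < (r : R) by exact: lt_nbhsr.
have dvq := is_derive_comp1 (sol_derive (q t) (ltW t0)) dq.
have dD : is_derive t (1 : R) (fun r => v (Num.max r 0) (q r) - v t (q r)) (w (q t)).
  apply: is_derive_eps => e e0.
  have e20 : 0 < e / 2 by lra.
  have cwq : {for t, continuous (fun r => w (q r))}.
    by apply: (@continuous_comp _ _ _ q w t); [exact: is_derive_cont dq|exact: cw].
  have Hw : \forall r \near t, `|w (q t) - w (q r)| <= e / 2.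
    by have /cvgrPdist_le/(_ _ e20) := cwq.
  apply: filterS3 (H _ e20) Hp Hw => r Hr r0 Hwr.
  rewrite (max_l (ltW t0)) (max_l (ltW r0)) subrr subr0.
  have -> : v r (q r) - v t (q r) - w (q t) * (r - t) =
    (v r (q r) - v t (q r) - (r - t) * w (q r)) - (w (q t) - w (q r)) * (r - t) by ring.
  apply: (le_trans (ler_normB _ _)).
  have -> : e * `|r - t| = e / 2 * `|r - t| + e / 2 * `|r - t| by field.
  by apply: lerD; [exact: Hr|rewrite normrM ler_wpM2r].
have := is_deriveD1 dvq dD.
rewrite (_ : (fun r => v t (q r) + (v (Num.max r 0) (q r) - v t (q r))) =
  (fun r => v (Num.max r 0) (q r)))//.
by apply/funext => r; rewrite addrC subrK.
Qed.

End solution.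

(** * Contradiction for a global solution *)

Section blowup.
Context {R : realType}.

Lemma global_solution_no_breaking (s kappa : R) (v0 : R -> R) (v : R -> R -> R) (a : R) :
  3 / 2 < s -> DP_solution s kappa v0 +oo v ->
  derive1 v0 a < - (Num.sqrt (3 / 2) * `|v0 a + kappa|) -> False.
Proof.
move=> hs [reg' cv v00 [vt [regt' _ dvt eqt]]] hbreak.
have ti (t : R) : 0 <= t -> time_interval +oo t by move=> t0; split => //; exact: ltry.
have reg (t : R) : 0 <= t -> sobolev_C1 s (v t) by move=> /ti; exact: reg'.
have {}v00 : v 0 = v0 by apply/funext.
(* Times are clamped to nonnegative values, where [v] is meaningful, so that continuity in time can
   be stated on the whole line. *)
pose c (t : R) := Num.max t 0.
have c0 t : 0 <= c t by rewrite /c le_max lexx orbT.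
have cc : continuous c.
  by apply: (@lipschitz_continuous _ _ 1) => x y; rewrite mul1r maxr0_lipschitz.
have cE t : 0 <= t -> c t = t by move=> t0; rewrite /c max_l.
pose V t := v (c t); pose Vx t := derive1 (v (c t)).
have near_c (t e : R) : 0 < e -> \forall r \near t, forall x : R,
    `|V (r : R) x - V t x| <= e /\ `|Vx r x - Vx t x| <= e.
  move=> e0; have H := sol_sup_continuous hs reg cv (c0 t) e0.
  have Hc : \forall r \near t, 0 <= c (r : R) -> forall x : R,
      `|v (c r) x - v (c t) x| <= e /\ `|derive1 (v (c r)) x - derive1 (v (c t)) x| <= e.
    exact: (cc t _ H).
  by apply: filterS Hc => r; apply.
have cV t : continuous (V t) by rewrite /V; move: (c0 t) => /(sol_continuous reg).
have cVx t : continuous (Vx t) by rewrite /Vx; move: (c0 t) => /(sol_derive_continuous reg).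
have jV : continuous (fun p : R * R => V p.1 p.2).
  apply: (@joint_continuous _ V) => [//|t e e0].
  by apply: filterS (near_c t e e0) => r Hr x; have [] := Hr x.
have jVx : continuous (fun p : R * R => Vx p.1 p.2).
  apply: (@joint_continuous _ Vx) => [//|t e e0].
  by apply: filterS (near_c t e e0) => r Hr x; have [] := Hr x.
have pV t : periodic1 (V t) by move: (c0 t) => /(sol_periodic reg).
have dV t (x : R) : is_derive x (1 : R) (V t) (Vx t x) by have := sol_derive reg x (c0 t).
have pVx t : periodic1 (Vx t) by exact: (periodic1_derive (dV t) (pV t)).
pose b : R := Num.sqrt (3 / 2).
(* The margin in the hypothesis. One half of it pays for replacing the slope at [a] by a difference
   quotient; the other half, [d], remains as a lower bound for [A] and [B] at time 0. *)
pose m := - derive1 v0 a - b * `|v0 a + kappa|.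
have m0 : 0 < m by rewrite /m; move: hbreak; rewrite -/b; lra.
pose d := m / 2; have d0 : 0 < d by rewrite /d; lra.
pose T := 2 / d; have T0 : 0 < T by rewrite divr_gt0.
have [M1 M10 HM1] := rectangle_bound (ltW T0) pV jV.
have [L1 L10 HL1] := rectangle_bound (ltW T0) pVx jVx.
pose L := L1 + 1; pose M := M1 + `|kappa|.
have L0 : 0 < L by rewrite /L; lra.
have M0 : 0 <= M by rewrite addr_ge0.
(* This is [min t T]. Combined with the clamp inside [V], it confines time to [[0, T]], where the
   bounds hold, so that the vector field is bounded and Lipschitz at all times as [picard]
   requires. *)
pose p t := T - c (T - t).
have cp : continuous p by rewrite /p; cont; apply: cont_comp cc _; cont.
have pE t : t <= T -> p t = t by move=> tT; rewrite /p cE ?subr_ge0//; ring.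
have pT t : 0 <= c (p t) <= T.
  rewrite c0/= /c ge_max (ltW T0) andbT /p.
  by have := c0 (T - t); lra.
have Vc t : V (c t) = V t by rewrite /V cE.
have Vxc t : Vx (c t) = Vx t by rewrite /Vx cE.
have bV t x : `|V (p t) x| <= M1 by rewrite -Vc HM1.
have bVx t x : `|Vx (p t) x| <= L by rewrite -Vxc (le_trans (HL1 _ _ (pT t)))// lerDl.
have flow x0 : exists2 q : R -> R, q 0 = x0 &
    forall t : R, 0 <= t -> is_derive t (1 : R) q (V (p t) (q t)).
  apply: (@picard _ (fun t => V (p t)) L M1 x0 L0) => //.
    by move=> q cq t; exact: cont_along jV (cp t) (cq t).
  by move=> t x y; rewrite (derive_lipschitz _ _ (dV (p t)) (bVx t)).
(* [h] is chosen last, after [T], [M] and [L]: small enough for the error of the Riccati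
   inequalities and for the difference quotient to be within [d] of the slope. *)
have quot : exists2 h, 0 < h & (3 * M * L + M ^+ 2) * (h * expR (L * T)) <= d ^+ 2 / 2 /\
    (v0 (a + h) - v0 a) / h < derive1 v0 a + d.
  have [g [gE cg ga]] := (is_derive1_caratheodory (v0 : R -> R) a (derive1 v0 a)).1
    (ltac:(by rewrite -v00; exact: (sol_derive reg a (lexx 0)))).
  have [r r0 Hr] := continuousP_at cg d0.
  pose K := (3 * M * L + M ^+ 2) * expR (L * T).
  have K0 : 0 <= K by rewrite mulr_ge0 ?expR_ge0// addr_ge0 ?sqr_ge0// !mulr_ge0// ltW.
  pose h := Num.min (r / 2) (d ^+ 2 / 2 / (K + 1)).
  have h0 : 0 < h by rewrite lt_min !divr_gt0// ?exprn_gt0// ltr_wpDl.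
  exists h => //; split.
    have -> : (3 * M * L + M ^+ 2) * (h * expR (L * T)) = h * K by rewrite /K; ring.
    apply: (@le_trans _ _ (h * (K + 1))); first by rewrite ler_pM2l// lerDl.
    by rewrite -ler_pdivlMr ?ltr_wpDl// /h ge_min lexx orbT.
  rewrite gE (addrC a) addrK mulfK ?gt_eqF//.
  have : `|g (h + a) - g a| < d.
    apply: Hr; rewrite addrK gtr0_norm// /h gt_min; apply/orP; left; lra.
  by rewrite ga => /(le_lt_trans (ler_norm _)); lra.
have [h h0 [small hq]] := quot.
have [q1 q10 dq1] := flow a; have [q2 q20 dq2] := flow (a + h).
have tp (t : R) : 0 < t -> (t%:E < +oo)%E by move=> _; exact: ltry.
pose good t XY := kernel_halves (fun x => 3 / 2 * (V t x + kappa) ^+ 2) XY.1 XY.2 /\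
  (forall e, 0 < e -> \forall r \near t, forall x : R,
      `|v (r : R) x - v t x - (r - t) * (- (v t x * derive1 (v t) x) - (XY.1 x - XY.2 x))| <= e * `|r - t|).
(* The two halves are selected time by time; zero functions are dummies for [t <= 0], where the
   equation gives no information. *)
have /choice [XY HXY] : forall t, exists XY : (R -> R) * (R -> R), 0 < t -> good t XY.
  move=> t; have [t0|_] := ltP 0 t; last by exists (cst 0, cst 0).
  have [X [Y [h1 h2]]] := sol_time_expansion hs reg (regt' t (ti t (ltW t0))) dvt t0 (eqt t t0 (tp t t0)).
  by exists (X, Y) => _; split => //=; rewrite /V cE// ltW.
have dalong q (t : R) : 0 < t < T -> (forall t : R, 0 <= t -> is_derive t (1 : R) q (V (p t) (q t))) ->
    is_derive t (1 : R) (fun t => V t (q t)) (- ((XY t).1 (q t) - (XY t).2 (q t))).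
  move=> /andP[t0 tT] dq.
  have := dq t (ltW t0); rewrite (pE _ (ltW tT)) /V cE ?(ltW t0)// => dqt.
  have [hk hr] := HXY t t0; have [_ _ dX dY] := hk.
  pose w x := - (v t x * derive1 (v t) x) - ((XY t).1 x - (XY t).2 x).
  have ct := sol_continuous reg (ltW t0); have cdt := sol_derive_continuous reg (ltW t0).
  have cX : continuous (XY t).1 by move=> x; exact: is_derive_cont (dX x).
  have cY : continuous (XY t).2 by move=> x; exact: is_derive_cont (dY x).
  have cw : continuous w by rewrite /w; cont.
  have := is_derive_along reg t0 cw hr dqt.
  by move=> H; apply: is_derive_val_eq H _; rewrite /w; ring.
apply: (@characteristic_blowup R V Vx (fun t => (XY t).1) (fun t => (XY t).2) kappa T M L d a h q1 q2) => //.
- move=> t x tT; move/andP: (tT) => [_ tT'].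
  rewrite -(pE _ tT'); split => //.
  by rewrite (le_trans (ler_normD _ _))// lerD2r.
- by move=> t /andP[t0 tT]; have [] := HXY t t0.
- move=> t /andP[t0 tT]; have := dq1 t t0; have := dq2 t t0; rewrite (pE _ tT) => ? ?.
  by split.
- move=> t /andP[t0 tT]; split; apply: cont_along jV _ _; try exact: cvg_id.
    exact: is_derive_cont (dq1 t t0).
  exact: is_derive_cont (dq2 t t0).
- by move=> t tT; split; exact: dalong.
- rewrite /V (cE 0)// v00; move: hq; rewrite /d /m -/b.
  have := ler_norm (- (v0 a + kappa)); rewrite normrN => h1.
  have := ler_wpM2l (sqrtr_ge0 (3 / 2) : 0 <= b) h1; lra.
- rewrite /V (cE 0)// v00; move: hq; rewrite /d /m -/b.
  have h1 := ler_norm (v0 a + kappa).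
  have := ler_wpM2l (sqrtr_ge0 (3 / 2) : 0 <= b) h1; lra.
Qed.

End blowup.

Unset Implicit Arguments.

Theorem proposition1p3 (R : realType) (s kappa : R) (v0 : R -> R)
    (hs : 3 / 2 < s)
    (hv0 : sobolev_C1 s v0)
    (hbreak : exists a : R,
       derive1 v0 a < - (Num.sqrt (3 / 2) * `|v0 a + kappa|))
    (Tstar : \bar R) (v : R -> R -> R)
    (hv : DP_maximal_solution s kappa v0 Tstar v) :
  (Tstar < +oo)%E.
Proof.
case: hbreak => a ha; rewrite ltey; apply/eqP => Too.
case: hv => _ _; rewrite Too => sol.
exact: (global_solution_no_breaking hs sol ha).
Qed.
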